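(* Let $k$ be a perfect field, let $\mathbf{E}\subset\{1,\dots,n\}$, and let $V\subset \mathbb{TA}^n_E$ be an affine toric embedding. Let $L\subset\mathbb{Z}^n$ be the lattice associated to $V$. Then $V$ is transversal to $E$ if and only if $L$ is transversal to $\mathbf{E}$.
   Context: For $\mathbf{E}\subset\{1,\dots,n\}$ set $\mathbb{TA}^n_E=\operatorname{Spec}\big(k[x_1,\dots,x_n]_{\prod_{i\notin\mathbf{E}}x_i}\big)$ (localization of the polynomial ring at the product of the $x_i$, $i\notin\mathbf{E}$); $E$ denotes the set of hypersurfaces $\{x_i=0\}$, $i\in\mathbf{E}$, of $\mathbb{TA}^n_E$. Let $\mathbb{T}^n=\operatorname{Spec}(k[x_1^{\pm1},\dots,x_n^{\pm1}])$. An affine toric variety is an affine variety $X$ (not necessarily normal) of dimension $d$ containing $\mathbb{T}^d$ as a dense open subset such that the action of the torus on itself extends to an action of $\mathbb{T}^d$ on $X$. An affine toric embedding $X\subset W$ is a reduced closed subscheme with $W$ a regular affine toric variety, $X$ an affine toric variety, and such that the inclusion is toric, i.e. gives a group homomorphism from the torus of $X$ to the torus of $W$. Lattice associated to $V\subset\mathbb{TA}^n_E$, $d=\dim V$: the inclusion of tori $\mathbb{T}^d\to\mathbb{T}^n$ corresponds to a surjective homomorphism of character groups $\mathbb{Z}^n\to\mathbb{Z}^d$, and $L$ is its kernel, a saturated $\mathbb{Z}$-submodule of rank $n-d$. Geometric transversality: $V\subset W$ is transversal to $E$ at a (closed) point $\xi\in V$ if there is a regular system of parameters $y_1,\dots,y_n$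 of $\mathcal{O}_{W,\xi}$ such that $I(V)_\xi=(y_1,\dots,y_r)$ for some $r\le n$, and for every $H\in E$ with $\xi\in H$ one has $I(H)_\xi=(y_i)$ for some $i$ with $r<i\le n$. $V$ is transversal to $E$ if it is so at every point of $V$. Lattice transversality: $\mathbb{Z}^n_{\mathbf{E}}=\{\alpha\in\mathbb{Z}^n\mid \alpha_j\ge0\ \forall j\in\mathbf{E}\}$. A $\mathbb{Z}$-submodule $L\subset\mathbb{Z}^n$ is weak-transversal to $\mathbf{E}$ if it admits a system of $\mathbb{Z}$-generators $\alpha_1,\dots,\alpha_\ell$ all lying in $\mathbb{Z}^n_{\mathbf{E}}$. $\operatorname{Sat}(L)=\{\alpha\in\mathbb{Z}^n\mid\lambda\alpha\in L\text{ for some nonzero }\lambda\in\mathbb{Z}\}$; $L$ is saturated if $\operatorname{Sat}(L)=L$. $L$ is transversal to $\mathbf{E}$ if it is weak-transversal to $\mathbf{E}$ and saturated. *)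

(* Defs.v *)
From HB Require Import structures.
From mathcomp Require Import all_boot all_order all_algebra.
From mathcomp.multinomials Require Import mpoly.
From mathcomp Require Import boolp.
From mathcomp Require Import fraction ring_quotient separable.

Set Implicit Arguments.
Unset Strict Implicit.
Unset Printing Implicit Defensive.

Import GRing.Theory.
Local Open Scope ring_scope.

Definition perfect_field (k : fieldType) : Prop :=
  forall p : {poly k}, irreducible_poly p -> separable_poly p.

Section CommutativeAlgebra.
Variable R : comNzRingType.

Definition prime_ideal (P : {pred R}) : Prop :=
  idealr_closed P /\ prime_idealr_closed P.

(* [idealr_closed] includes properness. *)
Definition maximal_ideal (M : {pred R}) : Prop :=
  idealr_closed M /\
  forall J : {pred R}, idealr_closed J -> {subset M <= J} -> J =i M.

(* P 0 < P 1 < ... < P l; the values of P beyond l are irrelevant. *)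
Definition prime_chain (l : nat) (P : nat -> {pred R}) : Prop :=
  (forall i, (i <= l)%N -> prime_ideal (P i)) /\
  (forall i, (i < l)%N ->
     {subset P i <= P i.+1} /\ exists2 f, f \in P i.+1 & f \notin P i).

Definition krull_dim (d : nat) : Prop :=
  (exists P, prime_chain d P) /\
  (forall l P, prime_chain l P -> (l <= d)%N).

Definition ideal_gen (m : nat) (S : pred 'I_m) (y : 'I_m -> R) : R -> Prop :=
  fun f => exists c : 'I_m -> R, f = \sum_(i | S i) c i * y i.

End CommutativeAlgebra.

Definition surjective (X Y : Type) (f : X -> Y) : Prop :=
  forall y, exists x, f x = y.

(* Spec B -> Spec A is an open immersion: Spec B is covered by preimages
   D(phi f) of basic open sets D(f) over which it is an isomorphism.  The last
   two clauses say that the induced map A_f -> B_(phi f) is injective and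
   surjective. *)
Definition open_immersion (A B : comNzRingType) (phi : {rmorphism A -> B}) :
  Prop :=
  exists (m : nat) (f : 'I_m -> A),
    [/\ ideal_gen predT (fun i => phi (f i)) 1,
        forall i a, phi a = 0 -> exists N, f i ^+ N * a = 0
      & forall i b, exists N a, phi (f i) ^+ N * b = phi a].

(* The image of Spec B -> Spec A meets every nonempty basic open set D(f). *)
Definition dominant (A B : comNzRingType) (phi : {rmorphism A -> B}) : Prop :=
  forall f : A, (exists2 P : {pred A}, prime_ideal P & f \notin P) ->
  exists2 Q : {pred B}, prime_ideal Q & phi f \notin Q.

Section ToricAffineSpace.
Variables (k : fieldType) (n : nat).

Local Notation ratfun := {fraction {mpoly k[n]}}.

Definition ratvar (i : 'I_n) : ratfun := tofrac ('X_i : {mpoly k[n]}).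

(* The localization of k[x_1, ..., x_n] at the product of the x_i, i \notin E,
   as a subring of k(x_1, ..., x_n). *)
Definition TA_pred (E : {set 'I_n}) : {pred ratfun} := fun f =>
  `[< exists (p : {mpoly k[n]}) (N : nat),
        f = tofrac p / (\prod_(i | i \notin E) ratvar i) ^+ N >].

Lemma ratvar_neq0 i : ratvar i != 0.
Proof.
rewrite /ratvar tofrac_eq0; apply/eqP => /(congr1 (mcoeff U_(i)%MM))/eqP.
by rewrite mcoeffX eqxx mcoeff0 oner_eq0.
Qed.

Lemma prod_ratvar_neq0 (P : pred 'I_n) N :
  (\prod_(i | P i) ratvar i) ^+ N != 0.
Proof.
by rewrite expf_neq0 //; apply/prodf_neq0 => i _; apply: ratvar_neq0.
Qed.

Lemma prod_ratvarE (P : pred 'I_n) :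
  \prod_(i | P i) ratvar i = tofrac (\prod_(i | P i) 'X_i : {mpoly k[n]}).
Proof. by rewrite rmorph_prod. Qed.

Lemma TA_subring E : subring_closed (TA_pred E).
Proof.
split.
- by apply/asboolP; exists 1, 0%N; rewrite expr0 divr1 tofrac1.
- move=> f g /asboolP[p [N ->]] /asboolP[q [M ->]]; apply/asboolP.
  set D := \prod_(i | _) _; have DN := prod_ratvar_neq0 [pred i | i \notin E].
  exists (p * (\prod_(i | i \notin E) 'X_i) ^+ M
          - q * (\prod_(i | i \notin E) 'X_i) ^+ N), (N + M)%N.
  rewrite tofracB !tofracM !tofracXn -prod_ratvarE -/D exprD.
  by rewrite -mulNr addf_div ?DN // mulNr.
- move=> f g /asboolP[p [N ->]] /asboolP[q [M ->]]; apply/asboolP.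
  by exists (p * q), (N + M)%N; rewrite tofracM exprD mulf_div.
Qed.

HB.instance Definition _ E :=
  GRing.isSubringClosed.Build ratfun (TA_pred E) (TA_subring E).

Record TA (E : {set 'I_n}) := MkTA { TA_val :> ratfun; _ : TA_val \in TA_pred E }.

HB.instance Definition _ E := [isSub for @TA_val E].
HB.instance Definition _ E := [Choice of TA E by <:].
HB.instance Definition _ E := [SubChoice_isSubComNzRing of TA E by <:].


Lemma TA_const_subproof E (c : k) : tofrac c%:MP_[n] \in TA_pred E.
Proof. by apply/asboolP; exists c%:MP, 0%N; rewrite expr0 divr1. Qed.

Definition TA_const E (c : k) : TA E := MkTA (TA_const_subproof E c).

Definition TA_scale E (c : k) (f : TA E) : TA E := TA_const E c * f.

Lemma TA_scaleA E a b (f : TA E) :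
  TA_scale a (TA_scale b f) = TA_scale (a * b) f.
Proof. by apply: val_inj; rewrite /= mulrA mpolyCM tofracM. Qed.

Lemma TA_scale1 E : left_id 1 (@TA_scale E).
Proof. by move=> f; apply: val_inj; rewrite /= mpolyC1 tofrac1 mul1r. Qed.

Lemma TA_scaleDr E : right_distributive (@TA_scale E) +%R.
Proof. by move=> a f g; apply: mulrDr. Qed.

Lemma TA_scaleDl E (f : TA E) :
  {morph (fun c => TA_scale c f) : a b / a + b}.
Proof. by move=> a b; apply: val_inj; rewrite /= mpolyCD tofracD mulrDl. Qed.

HB.instance Definition _ E := GRing.Zmodule_isLmodule.Build k (TA E)
  (@TA_scaleA E) (@TA_scale1 E) (@TA_scaleDr E) (@TA_scaleDl E).

Lemma TA_scaleAl E a (f g : TA E) : a *: (f * g) = a *: f * g.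
Proof. exact: mulrA. Qed.

HB.instance Definition _ E :=
  GRing.Lmodule_isLalgebra.Build k (TA E) (@TA_scaleAl E).
HB.instance Definition _ E := GRing.Lalgebra_isComAlgebra.Build k (TA E).

Lemma TA_var_subproof E i : ratvar i \in TA_pred E.
Proof. by apply/asboolP; exists 'X_i, 0%N; rewrite expr0 divr1. Qed.

Definition TA_var E i : TA E := MkTA (TA_var_subproof E i).

(* The coordinate ring of the torus T^n. *)
Definition torus : Type := TA set0.
HB.instance Definition _ := GRing.ComAlgebra.on torus.

Definition torus_var (i : 'I_n) : torus := TA_var set0 i.

Lemma TA_torus_subproof E (f : TA E) : TA_val f \in TA_pred set0.
Proof.
case: f => f /= /asboolP[p [N ->]]; apply/asboolP.
exists (p * (\prod_(i in E) 'X_i) ^+ N), N.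
rewrite tofracM tofracXn -prod_ratvarE.
have -> : \prod_(i | i \notin (set0 : {set 'I_n})) ratvar i
        = (\prod_(i in E) ratvar i) * \prod_(i | i \notin E) ratvar i.
  by rewrite (bigID (mem E)) /=; congr (_ * _); apply: eq_bigl => i;
     rewrite !inE.
by rewrite exprMn invfM mulrA mulfK ?prod_ratvar_neq0.
Qed.

(* Restriction of functions along the open inclusion of T^n in TA^n_E. *)
Definition TA_torus E (f : TA E) : torus := MkTA (TA_torus_subproof f).


Lemma ratvarV_TA0 i : (ratvar i)^-1 \in TA_pred set0.
Proof.
apply/asboolP; exists (\prod_(j | j != i) 'X_j), 1%N; rewrite expr1.
rewrite -prod_ratvarE.
have -> : \prod_(j | j \notin (set0 : {set 'I_n})) ratvar j
        = ratvar i * \prod_(j | j != i) ratvar j.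
  by rewrite (bigD1 i) ?inE //=; congr (_ * _); apply: eq_bigl => j;
     rewrite inE.
have N := prod_ratvar_neq0 (fun j => j != i) 1; rewrite expr1 in N.
by rewrite invfM mulrCA divff ?mulr1.
Qed.

Lemma torus_char_subproof (a : 'rV[int]_n) :
  \prod_i ratvar i ^ a 0 i \in TA_pred set0.
Proof.
apply: rpred_prod => i _; case: (a 0 i) => m.
  exact: rpredX (TA_var_subproof set0 i).
by rewrite NegzE -exprz_inv; apply: rpredX (ratvarV_TA0 i).
Qed.

Definition torus_char (a : 'rV[int]_n) : torus := MkTA (torus_char_subproof a).

End ToricAffineSpace.

Arguments TA : clear implicits.
Arguments torus : clear implicits.

(* Schemes over k are handled through their functors of points: the S-points of
   Spec A are the k-algebra morphisms A -> S. *)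
Notation points A S := {lrmorphism A -> S} (only parsing).

Section TorusAction.
Variable k : fieldType.

(* gh is the product of g and h in the group T^n(S): points of the torus are
   multiplied coordinatewise. *)
Definition torus_mul (n : nat) (S : comAlgType k)
    (g h gh : points (torus k n) S) : Prop :=
  forall i, gh (torus_var k i) = g (torus_var k i) * h (torus_var k i).

Definition torus_one (n : nat) (S : comAlgType k)
    (e : points (torus k n) S) : Prop :=
  forall i, e (torus_var k i) = 1.

(* Spec tau : T^d -> T^n is a group homomorphism. *)
Definition torus_morphism (n d : nat)
    (tau : {lrmorphism torus k n -> torus k d}) : Prop :=
  forall (S : comAlgType k) (g h gh : points (torus k d) S),
    torus_mul g h gh -> torus_mul (g \o tau) (h \o tau) (gh \o tau).

(* A family of maps T^d(S) x X(S) -> X(S), X = Spec A; it is a morphism of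
   schemes T^d x X -> X when natural in S (first clause of is_action). *)
Definition preaction (d : nat) (A : comAlgType k) : Type :=
  forall S : comAlgType k,
    points (torus k d) S -> points A S -> points A S.

Definition is_action (d : nat) (A : comAlgType k) (act : preaction d A) : Prop :=
  [/\ forall (S S' : comAlgType k) (f : {lrmorphism S -> S'})
           (g : points (torus k d) S) (x : points A S),
        act S' (f \o g) (f \o x) =1 f \o act S g x,
      forall (S : comAlgType k) (e : points (torus k d) S)
           (x : points A S),
        torus_one e -> act S e x =1 x
    & forall (S : comAlgType k) (g h gh : points (torus k d) S)
           (x : points A S),
        torus_mul g h gh -> act S gh x =1 act S g (act S h x)].

(* Spec A is an affine toric variety of dimension d with torus
   Spec j : T^d -> Spec A. *)
Record affine_toric_variety (d : nat) (A : comAlgType k)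
    (j : {lrmorphism A -> torus k d}) : Prop := AffineToricVariety {
  toric_fintype :
    exists (m : nat) (p : {lrmorphism {mpoly k[m]} -> A}), surjective p;
  toric_integral : GRing.integral_domain_axiom A;
  toric_dim : krull_dim A d;
  toric_open : open_immersion j;
  toric_dense : dominant j;
  toric_action : exists2 act : preaction d A, is_action act &
    forall (S : comAlgType k) (g h gh : points (torus k d) S),
      torus_mul g h gh -> act S g (h \o j) =1 gh \o j }.

(* Spec A, with torus Spec j : T^d -> Spec A, is an affine toric embedding in
   TA^n_E through Spec pi, whose restriction to the tori is Spec tau. *)
Record toric_embedding (n : nat) (E : {set 'I_n}) (d : nat) (A : comAlgType k)
    (pi : {lrmorphism TA k n E -> A}) (j : {lrmorphism A -> torus k d})
    (tau : {lrmorphism torus k n -> torus k d}) : Prop := ToricEmbedding {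
  embedding_closed : surjective pi;
  embedding_toric : affine_toric_variety j;
  embedding_torus : forall f : TA k n E, tau (TA_torus f) = j (pi f);
  embedding_morphism : torus_morphism tau }.

(* The kernel of the homomorphism of character groups Z^n -> Z^d. *)
Definition toric_lattice (n d : nat)
    (tau : {lrmorphism torus k n -> torus k d}) : 'rV[int]_n -> Prop :=
  fun a => tau (torus_char k a) = 1.

End TorusAction.

Section LocalRing.
Variables (k : fieldType) (n : nat) (E : {set 'I_n}).
Variable xi : prime_idealr (TA k n E).

(* The local ring of TA^n_E at xi, as a subring of k(x_1, ..., x_n). *)
Definition local_pred : {pred {fraction {mpoly k[n]}}} := fun f =>
  `[< exists a s : TA k n E, s \notin xi /\ f = TA_val a / TA_val s >].

Lemma local_den_neq0 (s : TA k n E) : s \notin xi -> TA_val s != 0.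
Proof.
apply: contraNneq => s0; suff -> : s = 0 by exact: rpred0.
exact: val_inj.
Qed.

Lemma local_subring : subring_closed local_pred.
Proof.
split.
- by apply/asboolP; exists 1, 1; rewrite idealr1 divr1.
- move=> f g /asboolP[a [s [Ns ->]]] /asboolP[b [t [Nt ->]]]; apply/asboolP.
  exists (a * t - b * s), (s * t); rewrite prime_idealrM negb_or Ns Nt.
  split=> //=; rewrite -mulNr addf_div ?local_den_neq0 //.
  by rewrite mulNr.
- move=> f g /asboolP[a [s [Ns ->]]] /asboolP[b [t [Nt ->]]]; apply/asboolP.
  exists (a * b), (s * t); rewrite prime_idealrM negb_or Ns Nt.
  by split=> //=; rewrite mulf_div.
Qed.

HB.instance Definition _ :=
  GRing.isSubringClosed.Build {fraction {mpoly k[n]}} local_pred local_subring.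

Record local_ring := MkLocal {
  local_val :> {fraction {mpoly k[n]}}; _ : local_val \in local_pred }.

HB.instance Definition _ := [isSub for local_val].
HB.instance Definition _ := [Choice of local_ring by <:].
HB.instance Definition _ := [SubChoice_isSubComNzRing of local_ring by <:].

(* The extension to the local ring of the ideal I. *)
Definition ideal_at (I : TA k n E -> Prop) : local_ring -> Prop := fun f =>
  exists a s, [/\ I a, s \notin xi & local_val f = TA_val a / TA_val s].

Definition regular_system_of_parameters (m : nat) (y : 'I_m -> local_ring) :
  Prop :=
  krull_dim local_ring m /\
  forall f, ideal_at (fun a => a \in xi) f <-> ideal_gen predT y f.

(* Indices start at 0: y_1, ..., y_r are the y i with i < r. *)
Definition transversal_at (I : TA k n E -> Prop) : Prop :=
  exists (r : nat) (y : 'I_n -> local_ring),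
    [/\ (r <= n)%N,
        regular_system_of_parameters y,
        forall f, ideal_at I f <-> ideal_gen (fun i : 'I_n => (i < r)%N) y f
      & forall h, h \in E -> TA_var k E h \in xi ->
          exists2 i : 'I_n, (r <= i)%N &
            forall f, ideal_at (ideal_gen predT (fun _ : 'I_1 => TA_var k E h)) f
                  <-> ideal_gen (pred1 i) y f].

End LocalRing.

(* Transversality to E of the closed subscheme of TA^n_E with ideal I, at all
   its closed points. *)
Definition geom_transversal (k : fieldType) (n : nat) (E : {set 'I_n})
    (I : TA k n E -> Prop) : Prop :=
  forall xi : prime_idealr (TA k n E), maximal_ideal xi ->
    (forall f, I f -> f \in xi) -> transversal_at xi I.

Section Lattice.
Variables (n : nat) (E : {set 'I_n}) (L : 'rV[int]_n -> Prop).

Definition nonneg_on (a : 'rV[int]_n) : Prop := forall j, j \in E -> 0 <= a 0 j.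

Definition weak_transversal : Prop :=
  exists (l : nat) (a : 'I_l -> 'rV[int]_n),
    (forall i, nonneg_on (a i)) /\
    forall b, L b <-> exists c : 'I_l -> int, b = \sum_i c i *: a i.

Definition Sat : 'rV[int]_n -> Prop := fun a =>
  exists2 z : int, z != 0 & L (z *: a).

Definition saturated : Prop := forall a, Sat a <-> L a.

Definition lattice_transversal : Prop := weak_transversal /\ saturated.

End Lattice.

(* Main.v *)
(* The map [tau] sends monomials to Laurent monomials, so I(V) is spanned by the
   binomials x^p - x^q with p - q in L.

   Suppose that V is transversal to E.  Let Z be the set of the h in E such that
   no element of L that is nonnegative on E is positive at h.  The point with
   coordinates 0 on Z and 1 elsewhere lies on V, and its local ring shows, by
   Nakayama's lemma, that I(V) is generated there by the binomials of the
   sublattice of L vanishing on Z; hence L vanishes on Z.  Then L contains an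
   element that is positive on E outside Z, and adding a large multiple of it
   to a basis yields generators of L that are nonnegative on E.

   Conversely, at a closed point xi of V let Z be the set of the h with
   x_h(xi) = 0.  If x^p - x^q vanishes at xi and p - q >= 0 on E, then p - q
   vanishes on Z; so L lies in the lattice of exponents vanishing on Z.  Choose a
   basis of the latter whose first r elements form a basis of L.  The parameters
   at xi are the monomials of these r elements minus 1, lifts of minimal
   polynomials of the residues of the other monomials, each over the previous
   ones, and the x_h with h in Z. *)
Require Import Defs.
From HB Require Import structures.
From mathcomp Require Import all_boot all_order all_algebra.
From mathcomp.multinomials Require Import mpoly.
From mathcomp Require Import boolp.
From mathcomp Require Import ring zify.
Set Implicit Arguments.
Unset Strict Implicit.
Unset Printing Implicit Defensive.
Import Order.TTheory GRing.Theory Num.Theory.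
Local Open Scope ring_scope.

(** * Zariski's lemma *)

(** A closed point is in general not rational, so in the converse regularity comes from counting:
    [n] elements generating the maximal ideal of a local ring of dimension [n] form a regular system
    of parameters. This asks for the dimension of the local ring and for a residue field algebraic
    over [k], whence Zariski's lemma; algebraicity gives both the minimal polynomials and a chain of
    primes of length [n]. The forward implication uses transversality at one rational point only,
    where differentials show that the coefficients of any relation between the parameters lie in the
    maximal ideal. Splitting off from an element of [I(V)] the monomials without variables in [Z]
    leaves an element that lies both in the ideal of the first [r] parameters and in that of the
    other ones, hence in [xi I(V)]. This is what Nakayama's lemma is fed with. *)

Section AdjoinHom.
Variables (A B : comNzRingType) (iota : {rmorphism A -> B}) (a : B).

Lemma adjoin_commr : commr_rmorph iota a.
Proof. by move=> x; apply: mulrC. Qed.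

Definition adjoin : {rmorphism {poly A} -> B} := horner_morph adjoin_commr.

Lemma adjoinE p : adjoin p = (map_poly iota p).[a].
Proof. by []. Qed.

Lemma adjoinC x : adjoin x%:P = iota x.
Proof. exact: horner_morphC. Qed.

Lemma adjoinX : adjoin 'X = a.
Proof. exact: horner_morphX. Qed.

Lemma adjoin_coef p : adjoin p = \sum_(i < size p) iota p`_i * a ^+ i.
Proof.
rewrite adjoinE (@horner_coef_wide _ (size p)) ?size_poly //.
by apply: eq_bigr => i _; rewrite coef_map.
Qed.

End AdjoinHom.

(** Membership in the subalgebra generated by [s], encoded through stable predicates: a claim about
    all generated elements is proved by exhibiting one such predicate. *)
Definition adjoined (A B : comNzRingType) (iota : A -> B) (s : seq B) (u : B) :
  Prop :=
  forall S : B -> Prop, (forall x, S (iota x)) -> (forall a, a \in s -> S a) ->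
    (forall u v, S u -> S v -> S (u + v)) ->
    (forall u v, S u -> S v -> S (u * v)) -> S u.

Section Adjoined.
Variables (A B : comNzRingType) (iota : {rmorphism A -> B}).

Lemma adjoinedD s u v : adjoined iota s u -> adjoined iota s v -> adjoined iota s (u + v).
Proof.
move=> gu gv T Tk Ts TD TM.
by apply: (TD); [exact: (gu T Tk Ts TD TM) | exact: (gv T Tk Ts TD TM)].
Qed.

Lemma adjoinedM s u v : adjoined iota s u -> adjoined iota s v -> adjoined iota s (u * v).
Proof.
move=> gu gv T Tk Ts TD TM.
by apply: (TM); [exact: (gu T Tk Ts TD TM) | exact: (gv T Tk Ts TD TM)].
Qed.

Lemma adjoined1 s : adjoined iota s 1.
Proof. by move=> T Tk _ _ _; rewrite -(rmorph1 iota); apply: Tk. Qed.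

Lemma adjoined_nil u : adjoined iota [::] u -> exists x, iota x = u.
Proof.
move=> gen; apply: (gen (fun u => exists x, iota x = u)) => //.
- by move=> x; exists x.
- by move=> _ _ [x <-] [y <-]; exists (x + y); rewrite rmorphD.
- by move=> _ _ [x <-] [y <-]; exists (x * y); rewrite rmorphM.
Qed.

(** The new base is the polynomial ring itself, not its image in [B]; this is why nonvanishing is
    tested after [iota] in what follows. *)
Lemma adjoined_cons a s u :
  adjoined iota (a :: s) u -> adjoined (adjoin iota a) s u.
Proof.
move=> gen S SA Ss SD SM; apply: gen => //.
  by move=> x; rewrite -(adjoinC iota a); apply: SA.
move=> b; rewrite inE => /orP[/eqP->|]; last exact: Ss.
by rewrite -(adjoinX iota a); apply: SA.
Qed.

End Adjoined.

Section Zariski.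
Variable D : idomainType.

Section Adjoin.
Variables (A : comNzRingType) (iota : {rmorphism A -> D}) (a : D).
Local Notation adjoin := (adjoin iota a).

(** As [iota] need not be injective, the top coefficients of [p] may die in [D]; cutting [p] at the
    degree of its image removes them. *)
Lemma root_truncate (p : {poly A}) : map_poly iota p != 0 -> adjoin p = 0 ->
  exists q : {poly A}, [/\ (size q <= size p)%N, iota (lead_coef q) != 0 & adjoin q = 0].
Proof.
move=> np pa0; pose q := take_poly (size (map_poly iota p)) p.
have eqpq : map_poly iota q = map_poly iota p.
  apply/polyP => i; rewrite !coef_map coef_take_poly; case: (ltnP i) => // le_i.
  by rewrite -(coef_map iota p) (nth_default _ le_i) raddf0.
have sqp : (size q <= size p)%N.
  by rewrite (leq_trans (size_take_poly _ _)) // size_poly.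
exists q; split=> //; last by rewrite adjoinE eqpq.
suff sq : size q = size (map_poly iota p).
  rewrite /lead_coef sq -coef_map eqpq -/(lead_coef _).
  by rewrite lead_coef_eq0.
by apply/eqP; rewrite eqn_leq [X in X && _]size_take_poly -{1}eqpq size_poly.
Qed.

(** Multiplying [b a^(m+1) + ... = 0] by [b^m] gives a monic equation for [b a]. *)
Lemma integral_lead_mul (p : {poly A}) : iota (lead_coef p) != 0 ->
  adjoin p = 0 -> integralOver iota (iota (lead_coef p) * a).
Proof.
set b := lead_coef p => nb pa0.
have [m sp] : exists m, size p = m.+2.
  case sp: (size p) => [|[|m]]; last by exists m.
    by move: nb; rewrite /b /lead_coef sp nth_default ?sp // rmorph0 eqxx.
  move: pa0 nb; rewrite adjoin_coef sp big_ord1 expr0 mulr1 /b /lead_coef sp /=.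
  by move=> ->; rewrite eqxx.
pose r := \poly_(i < m.+1) (p`_i * b ^+ (m - i)).
have sr : leq (size r).+1 (size ('X^(m.+1) : {poly A})) by rewrite size_polyXn ltnS size_poly.
exists ('X^(m.+1) + r).
  by rewrite monicE lead_coefDl // lead_coefXn.
apply/rootP; rewrite rmorphD /= map_polyXn hornerD hornerXn.
rewrite (@horner_coef_wide _ m.+1); last exact: leq_trans (size_poly _ _) (size_poly _ _).
transitivity (iota b ^+ m * adjoin p); last by rewrite pa0 mulr0.
rewrite adjoin_coef sp [in RHS]big_ord_recr /= [LHS]addrC mulrDr; congr (_ + _).
  rewrite mulr_sumr; apply: eq_bigr => i _.
  rewrite coef_map coef_poly ltn_ord /= rmorphM rmorphXn exprMn.
  have -> : iota b ^+ m = iota b ^+ (m - i) * iota b ^+ i.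
    by rewrite -exprD subnK // -ltnS.
  ring.
have -> : p`_m.+1 = b by rewrite /b /lead_coef sp.
by rewrite exprMn mulrA -exprSr.
Qed.

(** Each term [b^(size z) z_i a^i] is a multiple of [(b a)^i] with coefficient from [A]. *)
Lemma integral_adjoin_mul (b : A) (z : {poly A}) :
  integralOver iota (iota b * a) ->
  integralOver iota (iota b ^+ size z * adjoin z).
Proof.
move=> int_ba.
pose q := \poly_(i < size z) iota (z`_i * b ^+ (size z - i)).
have -> : iota b ^+ size z * adjoin z = q.[iota b * a].
  rewrite adjoin_coef (@horner_coef_wide _ (size z)) ?size_poly //.
  rewrite mulr_sumr; apply: eq_bigr => i _.
  rewrite coef_poly ltn_ord rmorphM rmorphXn exprMn.
  have -> : iota b ^+ size z = iota b ^+ (size z - i) * iota b ^+ i.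
    by rewrite -exprD subnK // ltnW.
  ring.
apply: integral_horner => //; apply/integral_poly => i; rewrite coef_poly.
by case: ifP => _; [apply: integral_id | apply: integral0].
Qed.

(** Factors [X] are split off [p] until the constant term [c] survives in [D]; then [-c] is [a]
    times a polynomial in [a]. *)
Lemma algebraic_multiple (p : {poly A}) : map_poly iota p != 0 ->
  adjoin p = 0 -> a != 0 ->
  exists e q, iota e != 0 /\ iota e = a * adjoin q.
Proof.
move=> + + na; elim/poly_ind: p => [|q c IH]; first by rewrite rmorph0 eqxx.
rewrite rmorphD rmorphM /= map_polyX map_polyC /=.
rewrite rmorphD rmorphM /= adjoinX adjoinC => nz.
have [c0|nc] := eqVneq (iota c) 0.
  rewrite c0 addr0 => /eqP; rewrite mulf_eq0 (negPf na) orbF => /eqP q0.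
  by apply: IH q0; apply: contraNneq nz => ->; rewrite c0 polyC0 mul0r addr0.
move=> /eqP; rewrite addr_eq0 => /eqP e0.
exists (- c), q; rewrite rmorphN oppr_eq0 nc; split=> //.
by rewrite -e0 mulrC.
Qed.

End Adjoin.

(* [c] witnesses that the localization of [iota A] at [c] is a field. *)
Definition field_locus (A : comNzRingType) (iota : A -> D) (c : A) : Prop :=
  iota c != 0 /\
  forall x, iota x != 0 -> exists N y, iota x * iota y = iota c ^+ N.

(* If [a] were transcendental, [1 + X c] would be a unit up to powers of [c],
   although it is prime to [c]. *)
Lemma field_locus_algebraic (A : comNzRingType) (iota : {rmorphism A -> D}) a c :
  field_locus (adjoin iota a) c ->
  exists2 p, map_poly iota p != 0 & adjoin iota a p = 0.
Proof.
move=> [nc field_c]; apply: contrapT => trans.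
have inj p : adjoin iota a p = 0 -> map_poly iota p = 0.
  by move=> p0; have [//|np] := eqVneq (map_poly iota p) 0; case: trans; exists p.
set cc := map_poly iota c.
have ncc : cc != 0 by apply: contraNneq nc => c0; rewrite adjoinE -/cc c0 horner0.
have sf : size (1 + 'X * cc) = (size cc).+1.
  rewrite addrC size_polyDl; rewrite mulrC size_mulX // size_poly1 ltnS.
  by rewrite lt0n size_poly_eq0.
have nf : adjoin iota a (1 + 'X * c) != 0.
  apply/eqP => /inj; rewrite rmorphD rmorphM rmorph1 /= map_polyX -/cc => f0.
  by move: sf; rewrite f0 size_poly0.
have [N [y /eqP]] := field_c _ nf.
rewrite -rmorphM -rmorphXn -subr_eq0 -rmorphB => /eqP/inj/eqP.
rewrite rmorphB rmorphM rmorphXn rmorphD rmorphM rmorph1 /= map_polyX -/cc.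
rewrite subr_eq0; set f := 1 + 'X * cc; set yy := map_poly iota y => /eqP eqf.
have [t et] : exists t, ('X * cc) ^+ N = f * t + (-1) ^+ N.
  elim: {eqf} N => [|N [t IH]]; first by exists 0; rewrite mulr0 add0r.
  by exists ('X * cc * t + (-1) ^+ N); rewrite exprS IH exprS /f; ring.
have : size (f * ('X ^+ N * yy - t)) == 1%N.
  have -> : f * ('X ^+ N * yy - t) = (-1) ^+ N.
    have -> : f * ('X ^+ N * yy - t) = 'X ^+ N * (f * yy) - f * t by ring.
    by rewrite eqf -exprMn et addrC addKr.
  by rewrite -signr_odd; case: odd; rewrite ?expr1 ?expr0 ?size_polyN size_poly1.
by rewrite size_mul_eq1 sf eqSS size_poly_eq0 (negPf ncc).
Qed.

(** Descent from [A[X]] to [A]: [b] makes [a] integral, and [e], from [A], is a nonzero multiple of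
    the localizing element of [A[X]]. A nonzero [x] of [A] then has an inverse up to powers of [b]
    and [e] that is integral; its equation, multiplied by a power of [x], brings it back into [A],
    as for a field integral over a subring. *)
Lemma field_locus_exists (s : seq D) (A : comNzRingType)
    (iota : {rmorphism A -> D}) :
  (forall u : D, u != 0 -> exists v, u * v = 1) ->
  (forall u, adjoined iota s u) -> exists c, field_locus iota c.
Proof.
move=> Dfield; elim: s A iota => [|a s IH] A iota gen.
  have surj u := adjoined_nil (gen u).
  exists 1; split=> [|x nx]; first by rewrite rmorph1 oner_eq0.
  have [v xv1] := Dfield _ nx; have [y ey] := surj v.
  by exists 0%N, y; rewrite ey.
have [c fc] := IH _ _ (fun u => adjoined_cons (gen u)).
have [p0 np0 p0a] := field_locus_algebraic fc.
have [p [_ nb pa]] := root_truncate np0 p0a.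
case: fc => nc field_c; set b := lead_coef p in nb.
have int_ba : integralOver iota (iota b * a) by apply: integral_lead_mul.
have int_z z : exists M, integralOver iota (iota b ^+ M * adjoin iota a z).
  by exists (size z); apply: integral_adjoin_mul.
have [M1 [pc mon_pc /rootP pc0]] := int_z c.
set v := _ * _ in pc0; have nv : v != 0 by rewrite mulf_neq0 ?expf_neq0.
have npc : map_poly iota pc != 0 by apply/monic_neq0/monic_map.
have [e [q [ne eE]]] := algebraic_multiple npc pc0 nv.
exists (b * e); split=> [|x nx]; first by rewrite rmorphM mulf_neq0.
have nx' : adjoin iota a x%:P != 0 by rewrite adjoinC.
have [N [y xy]] := field_c _ nx'; rewrite adjoinC in xy.
have [w ew] : exists w, iota x * adjoin iota a w = iota e ^+ N.
  pose vp := (b ^+ M1)%:P * c; have vpE : adjoin iota a vp = v.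
    by rewrite rmorphM adjoinC rmorphXn.
  exists (y * ((b ^+ M1)%:P * (q \Po vp)) ^+ N).
  rewrite rmorphM rmorphXn rmorphM adjoinC mulrA xy -exprMn eE rmorphXn.
  congr (_ ^+ N); rewrite /v mulrCA !mulrA; congr (_ * _).
  rewrite !adjoinE map_comp_poly horner_comp; congr (_.[_]).
  exact: vpE.
have [M [r mon_r /rootP r0]] := int_z w.
set z := _ * _ in r0.
have xz : iota x * z = iota b ^+ M * iota e ^+ N by rewrite -ew /z; ring.
have [t et] : exists t, iota x * iota t = (iota x * z) ^+ (size r).-1.
  pose m := (size r).-1.
  (* Read off the equation of [z] multiplied by [x^m]: [x^m z^i = x x^(m-1-i) (x z)^i], and [x z]
     comes from [A]. *)
  exists (- \sum_(i < m) r`_i * (x ^+ (m.-1 - i)) * (b ^+ M * e ^+ N) ^+ i).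
  have sr : size (map_poly iota r) = m.+1.
    rewrite size_map_poly_id0 ?(monicP mon_r) ?rmorph1 ?oner_eq0 //.
    by rewrite /m prednK // lt0n size_poly_eq0 monic_neq0.
  move: r0; rewrite horner_coef sr big_ord_recr /= coef_map.
  have -> : r`_m = 1 by apply/(monicP mon_r).
  rewrite /= rmorph1 mul1r => /eqP; rewrite addrC addr_eq0 => /eqP zm.
  rewrite exprMn -/m zm rmorphN !mulrN; congr (- _).
  rewrite rmorph_sum !mulr_sumr; apply: eq_bigr => i _.
  rewrite !rmorphM !rmorphXn rmorphM !rmorphXn -xz coef_map /= exprMn.
  have -> : iota x ^+ m = iota x * iota x ^+ (m.-1 - i) * iota x ^+ i.
    rewrite -exprS -exprD; congr (_ ^+ _).
    by case: (m) i => [|m' i /=]; [case | rewrite addSn subnK // -ltnS].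
  ring.
rewrite xz in et.
set K := (size r).-1 in et.
exists ((M + N) * K)%N, (t * (b ^+ N * e ^+ M) ^+ K).
rewrite rmorphM mulrA et [RHS]exprM !(rmorphXn, rmorphM) /= -exprMn.
by congr (_ ^+ _); rewrite !exprMn !exprD; ring.
Qed.

(** The localizing element is taken over [k[X]], with [X] sent to [u], and not over [k]:
    [field_locus_algebraic] then yields an equation for [u] itself. *)
Lemma zariski (k : fieldType) (theta : {rmorphism k -> D}) (s : seq D) :
  (forall u : D, u != 0 -> exists v, u * v = 1) -> (forall u, adjoined theta s u) ->
  forall u, exists2 p, p != 0 & (map_poly theta p).[u] = 0.
Proof.
move=> Dfield gen u.
have gen_u v : adjoined (adjoin theta u) s v.
  by apply: adjoined_cons => S SA Ss; apply: gen => // b bs; apply: Ss;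
     rewrite inE bs orbT.
have [c fc] := field_locus_exists Dfield gen_u.
have [p np p0] := field_locus_algebraic fc.
by exists p => //; apply: contraNneq np => ->; rewrite rmorph0.
Qed.

End Zariski.

(** * Lifting generators of the residue field to parameters *)

Section TriangularGenerators.
Variables (k : fieldType) (B : comNzRingType) (K : idomainType).
Variables (thB : {rmorphism k -> B}) (phi : {rmorphism B -> K}).
Hypothesis alg : forall u : K,
  exists2 p : {poly k}, p != 0 & (map_poly (phi \o thB) p).[u] = 0.

(** The inverse of an algebraic element is a polynomial in it, so it lifts to [R]; the image of [R]
    in [K] is therefore a field. *)
Lemma inverse_mod_kernel (R : comNzRingType) (th : {rmorphism k -> R})
    (f : {rmorphism R -> K}) : (forall c, f (th c) = phi (thB c)) ->
  forall x, f x != 0 -> exists y, f (x * y) = 1.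
Proof.
move=> fth x nx; have [p np px] := alg (f x).
have [|e [q [ne eE]]] := algebraic_multiple (iota := phi \o thB) _ px nx.
  by rewrite map_poly_eq0.
exists (adjoin th x q * th e^-1).
have -> : f (x * (adjoin th x q * th e^-1)) = f x * f (adjoin th x q) * f (th e^-1).
  by rewrite !rmorphM mulrA.
have -> : f (adjoin th x q) = adjoin (phi \o thB) (f x) q.
  rewrite !adjoin_coef rmorph_sum; apply: eq_bigr => i _.
  by rewrite /= rmorphM rmorphXn fth.
rewrite -eE fth -[phi (thB _)]/((phi \o thB) e^-1) -rmorphM divff ?rmorph1 //.
by apply: contraNneq ne => ->; rewrite rmorph0.
Qed.

Definition is_ideal (J : B -> Prop) : Prop :=
  (forall u v, J u -> J v -> J (u + v)) /\ forall u v, J v -> J (u * v).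

Lemma is_ideal_sum (J : B -> Prop) (I : Type) (s : seq I) (P : pred I)
    (F : I -> B) : is_ideal J -> J 0 -> (forall i, P i -> J (F i)) ->
  J (\sum_(i <- s | P i) F i).
Proof. by move=> [JD JM] J0 JF; apply: big_ind => // *; apply: JD. Qed.

Section Step.
Variables (R : comNzRingType) (th : {rmorphism k -> R}) (rho : {rmorphism R -> B}).
Hypothesis rho_th : forall c, rho (th c) = thB c.

(** [G] lifts the minimal polynomial of [phi w] over the field that is the image of [R]. The third
    clause pins the lift down when [phi w] is a constant: this is what later makes the unit
    monomials minus 1 and the [x_h] themselves parameters. *)
Lemma minimal_monic (w : B) : exists G : {poly R},
  [/\ G \is monic, phi (adjoin rho w G) = 0,
      forall c, phi w = phi (thB c) -> adjoin rho w G = w - thB c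
    & forall P : {poly R}, (size P < size G)%N -> phi (adjoin rho w P) = 0 ->
        forall i, phi (rho P`_i) = 0].
Proof.
have adj_phi P : phi (adjoin rho w P) = adjoin (phi \o rho) (phi w) P.
  rewrite !adjoin_coef rmorph_sum; apply: eq_bigr => i _.
  by rewrite rmorphM rmorphXn.
pose Q n := `[< exists G : {poly R},
  [/\ G \is monic, phi (adjoin rho w G) = 0 & size G = n] >].
have exQ : exists n, Q n.
  have [p np pw] := alg (phi w).
  pose p1 := (lead_coef p)^-1 *: p.
  have mp1 : p1 \is monic.
    by rewrite monicE /p1 lead_coefZ mulVf ?lead_coef_eq0.
  exists (size (map_poly th p1)); apply/asboolP; exists (map_poly th p1).
  split=> //; first exact: monic_map.
  rewrite adj_phi adjoinE -map_poly_comp.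
  have -> : map_poly ((phi \o rho) \o th) p1 = map_poly (phi \o thB) p1.
    by apply: eq_map_poly => c /=; rewrite rho_th.
  by rewrite /p1 map_polyZ hornerZ pw mulr0.
have [G [mG G0 specG minG]] : exists G : {poly R},
  [/\ G \is monic, phi (adjoin rho w G) = 0,
      forall c, phi w = phi (thB c) -> adjoin rho w G = w - thB c
    & forall G', G' \is monic -> phi (adjoin rho w G') = 0 ->
        (size G <= size G')%N].
  (* Minimal size alone does not determine a lift, so a constant residue is treated apart, with
     [X - c]. *)
  have [[c wc]|nc] := pselect (exists c, phi w = phi (thB c)).
    exists ('X - (th c)%:P).
    have E : adjoin rho w ('X - (th c)%:P) = w - thB c.
      by rewrite rmorphB adjoinX adjoinC rho_th.
    split; first exact: monicXsubC.
    - by rewrite E rmorphB wc subrr.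
    - move=> c' wc'; rewrite E; congr (_ - thB _).
      by apply: (fmorph_inj (phi \o thB)); rewrite /= -wc -wc'.
    - move=> G' mG' G'0; rewrite size_XsubC ltnNge; apply/negP => sG'.
      have s1 : size G' = 1%N.
        by apply/eqP; rewrite eqn_leq sG' lt0n size_poly_eq0 monic_neq0.
      have G'1 : G' = 1.
        by rewrite (size1_polyC sG') (_ : G'`_0 = 1) //; move/monicP: mG'; rewrite lead_coefE s1.
      by move/eqP: G'0; rewrite G'1 !rmorph1 oner_eq0.
  case: (ex_minnP exQ) => n0 /asboolP[G [mG G0 sG]] minG.
  exists G; split=> // [c wc|G' mG' G'0]; first by case: nc; exists c.
  by rewrite sG; apply: minG; apply/asboolP; exists G'.
exists G; split=> // P sP P0 i.
(* If [P] had a nonzero image, making it monic modulo the kernel of [phi] would give a competitor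
   shorter than [G]. *)
have [P00|nP] := eqVneq (map_poly (phi \o rho) P) 0.
  by rewrite -[LHS](coef_map (phi \o rho) P) P00 coef0.
have [|P' [sP' nP' P'0]] := root_truncate nP (a := phi w).
  by rewrite -adj_phi.
have [c' cc'] := inverse_mod_kernel (f := phi \o rho) (th := th)
  (fun c => congr1 phi (rho_th c)) nP'.
have sP'0 : (0 < size P')%N.
  by rewrite lt0n size_poly_eq0; apply: contraNneq nP' => ->; rewrite lead_coef0 rmorph0.
pose m := (size P').-1; have sPm : size P' = m.+1 by rewrite /m prednK.
pose r := \poly_(i < m) (c' * P'`_i).
have sr : leq (size r).+1 (size ('X^m : {poly R})).
  by rewrite size_polyXn ltnS size_poly.
have := minG ('X^m + r).
rewrite monicE lead_coefDl // lead_coefXn eqxx size_polyDl // size_polyXn.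
rewrite adj_phi leqNgt (leq_trans _ sP) ?ltnS -?sPm //.
case/(_ isT _)/negP => //.
suff -> : adjoin (phi \o rho) (phi w) ('X^m + r) = phi (rho c') * adjoin (phi \o rho) (phi w) P'.
  by rewrite P'0 mulr0.
rewrite [in RHS]adjoin_coef sPm big_ord_recr /= mulrDr rmorphD rmorphXn adjoinX addrC; congr (_ + _).
  rewrite adjoinE (@horner_coef_wide _ m); last first.
    exact: leq_trans (size_poly _ _) (size_poly _ _).
  rewrite mulr_sumr; apply: eq_bigr => j _.
  by rewrite coef_map coef_poly ltn_ord /= !rmorphM mulrA.
rewrite mulrA -rmorphM -rmorphM mulrC.
have -> : P'`_m = lead_coef P' by rewrite lead_coefE sPm.
by rewrite [c' * _]mulrC [phi (rho _)]cc' mulr1.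
Qed.

End Step.

(* When the [ws] are adjoined one at a time, the i-th element of [gs] lifts the
   minimal polynomial of the residue of the i-th element of [ws] over the
   subring generated by the previous ones. *)
Lemma triangular_generators (ws : seq B) (R : comNzRingType)
    (th : {rmorphism k -> R}) (rho : {rmorphism R -> B}) :
  (forall c, rho (th c) = thB c) ->
  exists gs : seq B, [/\ size gs = size ws,
    forall i, (i < size ws)%N -> phi gs`_i = 0 /\
      forall c, phi ws`_i = phi (thB c) -> gs`_i = ws`_i - thB c
  & forall J : B -> Prop, is_ideal J -> J 0 ->
      (forall z, phi (rho z) = 0 -> J (rho z)) ->
      (forall i, (i < size gs)%N -> J gs`_i) ->
      forall u, adjoined rho ws u -> phi u = 0 -> J u].
Proof.
elim: ws R th rho => [|w ws IH] R th rho rho_th.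
  exists [::]; split=> // J _ _ Jker _ u /adjoined_nil[x <-]; exact: Jker.
have [G [mG G0 specG minG]] := minimal_monic rho_th w.
have [|gs [sgs specgs Jgs]] := IH _ (polyC \o th) (adjoin rho w).
  by move=> c; rewrite /= adjoinC.
exists (adjoin rho w G :: gs); split=> [|[|i] lti|J idJ J0 Jker Jg u].
- by rewrite /= sgs.
- by split.
- exact: specgs.
move/adjoined_cons => Au u0; apply: (Jgs J) => // [P P0|i ltis]; last first.
  exact: (Jg i.+1).
have JGa : J (adjoin rho w G) by apply: (Jg 0%N).
have Jrem (Q : {poly R}) : (size Q < size G)%N -> phi (adjoin rho w Q) = 0 -> J (adjoin rho w Q).
  move=> sQ Q0; rewrite adjoin_coef; apply: is_ideal_sum => // i _.
  by rewrite mulrC; apply: idJ.2; apply: Jker; apply: minG.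
(* Division by the monic [G] works over any [R]; the remainder is shorter than [G], so its
   coefficients have residue 0 and the hypothesis on [J] applies to them. *)
have [Q [Rm [sRm eP]]] : exists (Q Rm : {poly R}), (size Rm < size G)%N /\ P = Q * G + Rm.
  exists (Pdiv.Ring.rdivp P G), (Pdiv.Ring.rmodp P G).
  by split; [rewrite Pdiv.Ring.ltn_rmodpN0 ?monic_neq0 | apply: Pdiv.RingMonic.rdivp_eq].
rewrite eP rmorphD rmorphM; apply: idJ.1; first exact: idJ.2.
apply: Jrem => //.
by move: P0; rewrite eP rmorphD rmorphM rmorphD rmorphM G0 mulr0 add0r.
Qed.

End TriangularGenerators.

(** * Krull dimension *)

Section AlgebraicDependence.
Variables (k : fieldType) (n : nat).

Lemma msupp_prod_mdeg (I : Type) (s : seq I) (F : I -> {mpoly k[n]}) (b : I -> nat) m :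
  (forall i m, m \in msupp (F i) -> (mdeg m <= b i)%N) ->
  m \in msupp (\prod_(i <- s) F i) -> (mdeg m <= \sum_(i <- s) b i)%N.
Proof.
move=> Fb; elim: s m => [|i s IH] m.
  by rewrite !big_nil -mpolyC1 msupp1 inE => /eqP->; rewrite mdeg0.
rewrite !big_cons => /msuppM_le/allpairsP[[m1 m2] /= [m1i m2s ->]].
by rewrite mdegD leq_add ?Fb ?IH.
Qed.

Lemma msupp_exp_mdeg (p : {mpoly k[n]}) (b e : nat) m :
  (forall m, m \in msupp p -> (mdeg m <= b)%N) ->
  m \in msupp (p ^+ e) -> (mdeg m <= e * b)%N.
Proof.
move=> pb; elim: e m => [|e IH] m.
  by rewrite expr0 -mpolyC1 msupp1 inE => /eqP->; rewrite mdeg0.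
rewrite exprS => /msuppM_le/allpairsP[[m1 m2] /= [m1p m2e ->]].
by rewrite mdegD mulSn leq_add ?pb ?IH.
Qed.

(* There are [D ^ (n + 1)] monomials in the [f i] with exponents less than [D],
   and they are supported on [(C D) ^ n] monomials; take [D > C ^ n]. *)
Lemma algebraic_dependence (f : 'I_n.+1 -> {mpoly k[n]}) :
  exists (D : nat) (c : {ffun 'I_n.+1 -> 'I_D} -> k),
    (exists m, c m != 0) /\ \sum_m c m *: \prod_i f i ^+ m i = 0.
Proof.
pose c0 := (\sum_i msize (f i))%N.+1; pose C := (n.+1 * c0)%N.
pose D := (C ^ n)%N.+1; pose B := (C * D)%N.
pose mon (m : {ffun 'I_n.+1 -> 'I_D}) := \prod_i f i ^+ m i.
pose mnm (g : {ffun 'I_n -> 'I_B}) : 'X_{1..n} := [multinom g i : nat | i < n].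
have monB m mm : mm \in msupp (mon m) -> (mdeg mm < B)%N.
  move=> /(msupp_prod_mdeg (b := fun i => (m i * c0)%N)) H.
  apply: leq_ltn_trans (H _) _ => [i m'|].
    apply: msupp_exp_mdeg => m1 /msize_mdeg_lt m1f.
    rewrite /c0 (bigD1 i) //= ltnW // ltnS (leq_trans (ltnW m1f)) //.
    exact: leq_addr.
  apply: leq_ltn_trans (_ : n.+1 * (D.-1 * c0) < B)%N.
    rewrite -[X in (_ <= X * _)%N]card_ord -sum_nat_const; apply: leq_sum => i _.
    by rewrite leq_mul2r -ltnS ltn_ord orbT.
  rewrite /B /C -mulnA (mulnC c0) ltn_mul2l ltn_mul2r.
  by apply/and3P; split=> //; apply: ltnSn.
pose M : 'M[k]_(#|{ffun 'I_n.+1 -> 'I_D}|, #|{ffun 'I_n -> 'I_B}|) :=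
  \matrix_(i, j) (mon (enum_val i))@_(mnm (enum_val j)).
have : ~~ row_free M.
  rewrite /row_free neq_ltn; apply/orP; left.
  apply: leq_ltn_trans (rank_leq_col _) _.
  by rewrite !card_ffun !card_ord /B expnMn [X in (_ < X)%N]expnS ltn_mul2r expn_gt0 /=.
rewrite -kermx_eq0 => /rowV0Pn[v /sub_kermxP vM /rV0Pn[i0 vi0]].
exists D, (fun m => v 0 (enum_rank m)); split.
  by exists (enum_val i0); rewrite enum_valK.
apply/mpolyP => mm; rewrite mcoeff0 raddf_sum /=.
have [mmB|/forallPn[i]] := boolP [forall i, mm i < B]%N; last first.
  rewrite -leqNgt => Bmm; apply: big1 => m _; rewrite mcoeffZ.
  suff /eqP-> : (mon m)@_mm == 0 by rewrite mulr0.
  rewrite mcoeff_eq0; apply/negP => /monB; apply/negP; rewrite -leqNgt.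
  by rewrite (leq_trans Bmm) // mdegE (bigD1 i) //= leq_addr.
pose g : {ffun 'I_n -> 'I_B} := [ffun i => Ordinal (forallP mmB i)].
have mmE : mm = mnm g by apply/mnmP => i; rewrite mnmE ffunE.
have := congr1 (fun u : 'rV_ _ => u 0 (enum_rank g)) vM; rewrite !mxE => E.
rewrite -[RHS]E (reindex _ (onW_bij _ (@enum_val_bij _))) /=.
apply: eq_bigr => i _.
by rewrite mcoeffZ enum_valK mxE enum_rankK -mmE.
Qed.

End AlgebraicDependence.

Section Ideals.
Variables (R : comNzRingType) (P : {pred R}).
Hypothesis idP : idealr_closed P.

Lemma idealr_closed0 : 0 \in P.
Proof. by case: idP. Qed.

Lemma idealr_closedD u v : u \in P -> v \in P -> u + v \in P.
Proof. by case: idP => _ _ H uP vP; rewrite -[u]mul1r H. Qed.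

Lemma idealr_closedM a u : u \in P -> a * u \in P.
Proof. by case: idP => P0 _ H uP; rewrite -[_ * _]addr0 H. Qed.

Lemma idealr_closedN u : u \in P -> - u \in P.
Proof. by rewrite -mulN1r; apply: idealr_closedM. Qed.

Lemma idealr_closed_sum (I : Type) (s : seq I) (Q : pred I) (F : I -> R) :
  (forall i, Q i -> F i \in P) -> \sum_(i <- s | Q i) F i \in P.
Proof.
by move=> FP; apply: (big_ind (fun u => u \in P)) => //;
   [exact: idealr_closed0 | exact: idealr_closedD].
Qed.

Lemma prime_idealr_closedX u e :
  prime_idealr_closed P -> u \notin P -> u ^+ e \notin P.
Proof.
move=> prP uP; elim: e => [|e IH]; first by case: idP.
by rewrite exprS; apply/negP => /prP; rewrite (negPf uP) (negPf IH).
Qed.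

End Ideals.

Section PrimeChains.
Variable R : comNzRingType.

(* Isolate the terms whose exponent of [x 0] is minimal and divide: the other
   terms die modulo [P 1]; iterate with [x 1], [x 2], ... *)
Lemma prime_chain_peel (N : nat) (P : nat -> {pred R}) (x : 'I_N -> R) (D : nat)
    (c : {ffun 'I_N -> 'I_D} -> R) :
  prime_chain N P -> (forall i : 'I_N, x i \in P i.+1 /\ x i \notin P i) ->
  (forall m, c m \in P N -> c m = 0) ->
  \sum_m c m * \prod_i x i ^+ m i = 0 -> forall m, c m = 0.
Proof.
move=> [primeP chainP] Px cP sum0 m0; apply: contrapT => cm0.
have step i : (i <= N)%N -> exists S : {set {ffun 'I_N -> 'I_D}},
  [/\ S != set0, {in S, forall m, c m <> 0},
     forall m m' (j : 'I_N), m \in S -> m' \in S -> (j < i)%N -> m j = m' j &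
     \sum_(m in S) c m * \prod_(j : 'I_N | (i <= j)%N) x j ^+ m j \in P i].
  elim: i => [|i IH] ltiN.
    exists [set m | c m != 0]; split.
    - by apply/set0Pn; exists m0; rewrite inE; apply/eqP.
    - by move=> m; rewrite inE => /eqP.
    - by [].
    - have -> : \sum_(m in [set m | c m != 0]) c m * \prod_(j : 'I_N | (0 <= j)%N) x j ^+ m j = 0.
        move: sum0; rewrite (bigID (fun m => c m == 0)) /= big1 ?add0r => [S0|]; last first.
          by move=> m /eqP->; rewrite mul0r.
        by rewrite -[RHS]S0; apply: eq_bigl => m; rewrite inE.
      exact: idealr_closed0 (primeP 0%N isT).1.
  have [S [nS cS eqS sumS]] := IH (ltnW ltiN); pose i' := Ordinal ltiN.
  have [m1 m1S] := set0Pn _ nS.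
  have [m2 m2S m2min] : exists2 m2 : {ffun 'I_N -> 'I_D}, m2 \in S &
      forall m, m \in S -> (m2 i' <= m i')%N.
    by case: (@arg_minnP _ m1 [pred m | m \in S] (fun m : {ffun 'I_N -> 'I_D} => m i' : nat) m1S) => m2;
       exists m2.
  exists [set m in S | m i' == m2 i']; split.
  - by apply/set0Pn; exists m2; rewrite inE m2S eqxx.
  - by move=> m; rewrite inE => /andP[/cS].
  - move=> m m' j; rewrite !inE => /andP[mS /eqP mi] /andP[m'S /eqP m'i].
    rewrite ltnS leq_eqVlt => /orP[/eqP ji|]; last exact: eqS.
    have -> : j = i' by apply/val_inj.
    by rewrite mi m'i.
  - set a := (m2 i' : nat) in m2min.
    have [idi pri] := primeP i (ltnW ltiN).
    have [idi1 pri1] := primeP i.+1 ltiN.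
    have [xi1 xi] := Px i'.
    pose F m := c m * \prod_(j : 'I_N | (i < j)%N) x j ^+ m j.
    have {}sumS : \sum_(m in S) F m * x i' ^+ (m i' - a) \in P i.
      have : x i' ^+ a * \sum_(m in S) F m * x i' ^+ (m i' - a) \in P i.
        rewrite mulr_sumr; congr (_ \in P i): sumS; apply: eq_bigr => m mS.
        rewrite (bigD1 i') //= -{1}(subnK (m2min m mS)) exprD -/a /F.
        rewrite [X in c m * (_ * X)](eq_bigl (fun j : 'I_N => i < j)%N); first ring.
        by move=> j; rewrite ltn_neqAle eq_sym andbC.
      by move/pri; rewrite (negPf (prime_idealr_closedX idi a pri xi)).
    have /(_ _ sumS) := (chainP i ltiN).1.
    rewrite (bigID (fun m : {ffun 'I_N -> 'I_D} => m i' == m2 i')) /=.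
    set T1 := \sum_(m in S | _) _; set T2 := \sum_(m in S | _) _ => T12.
    have T2P : T2 \in P i.+1.
      apply: (idealr_closed_sum idi1) => m /andP[mS ma].
      apply: (idealr_closedM idi1).
      have : (0 < m i' - a)%N by rewrite subn_gt0 ltn_neqAle eq_sym ma m2min.
      by case: (_ - _)%N => // e _; rewrite exprSr; apply: (idealr_closedM idi1).
    have -> : \sum_(m in [set m in S | m i' == m2 i']) c m * \prod_(j : 'I_N | (i < j)%N) x j ^+ m j = T1.
      apply: eq_big => m; rewrite inE // => /andP[_ /eqP ma].
      by rewrite ma subnn expr0 mulr1.
    by rewrite -[T1](addrK T2) (idealr_closedD idi1) ?(idealr_closedN idi1).
(* For [i = N] all exponents in [S] agree and the product is empty: a single coefficient remains,
   and it lies in [P N]. *)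
have [S [/set0Pn[m mS] cS eqS]] := step N (leqnn N).
rewrite (bigD1 m) //= [X in _ + X]big1 ?addr0 => [|m' /andP[m'S /eqP[]]]; last first.
  by apply/ffunP => j; apply: eqS => //; apply: ltn_ord.
rewrite big1 ?mulr1 => [/cP|j]; first exact: cS.
by rewrite leqNgt ltn_ord.
Qed.

End PrimeChains.

Section KrullDimension.
Variables (k : fieldType) (n : nat) (R : comNzRingType).
Variable iota : {rmorphism {mpoly k[n]} -> R}.
Hypothesis iota_frac : forall f : R, exists (p s : {mpoly k[n]}) (u : R),
  u * iota s = 1 /\ iota s * f = iota p.

(** Denominators are units, so the strict inclusions have polynomial witnesses. Any [n + 1] of them
    are algebraically dependent, while peeling kills every coefficient, since no nonzero constant
    lies in a prime. *)
Lemma prime_chain_leq l P : @prime_chain R l P -> (l <= n)%N.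
Proof.
move=> chP; rewrite leqNgt; apply/negP => ltnl; have [primeP chainP] := chP.
have /choice[p pP] : forall i : 'I_n.+1, exists p : {mpoly k[n]},
    iota p \in P i.+1 /\ iota p \notin P i.
  move=> i; have lil : (i < l)%N by rewrite (leq_trans _ ltnl).
  have [_ [f f1 f0]] := chainP i lil.
  have [p [s [u [us sf]]]] := iota_frac f; exists p; rewrite -sf; split.
    exact: idealr_closedM (primeP _ lil).1 _ _ f1.
  apply: contra f0 => sf0; rewrite -[f]mul1r -us -mulrA.
  exact: idealr_closedM (primeP _ (ltnW lil)).1 _ _ sf0.
have [D [c [[m cm] /(congr1 iota)]]] := algebraic_dependence p.
rewrite rmorph0 rmorph_sum => sum0.
have chP' : prime_chain n.+1 P.
  split=> i lei; first by apply: primeP; apply: leq_trans ltnl.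
  by apply: chainP; apply: leq_trans ltnl.
have constP : forall a : k, iota a%:MP \in P n.+1 -> a = 0.
  move=> a aP; apply: contraTeq isT => na.
  have [idP _] := primeP n.+1 ltnl; have [_ /negP P1 _] := idP.
  case: P1; have -> : 1 = iota (a^-1)%:MP * iota a%:MP.
    by rewrite -rmorphM -mpolyCM mulVf // mpolyC1 rmorph1.
  exact: (idealr_closedM idP).
move/eqP: cm; apply.
have := @prime_chain_peel R n.+1 P (fun i => iota (p i)) D (fun m => iota (c m)%:MP) chP' pP.
move=> /(_ _ _ m) H; apply: (constP (c m)); rewrite H.
- exact: idealr_closed0 (primeP _ ltnl).1.
- by move=> m' /constP->; rewrite mpolyC0 rmorph0.
rewrite -[RHS]sum0; apply: eq_bigr => m' _.
by rewrite -mul_mpolyC rmorphM rmorph_prod; congr (_ * _); apply: eq_bigr => i _; rewrite rmorphXn.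
Qed.

End KrullDimension.

(** * Laurent monomials *)

(** Smith form [M = V D W]: the rows of [U], the inverse of [V], are a basis of the whole lattice,
    and those facing a zero row of [D] are a basis of the left kernel. Coordinates in this basis are
    [a *m V]. *)
Lemma kernel_adapted_basis (c d : nat) (M : 'M[int]_(c, d)) :
  exists (U V : 'M[int]_c) (S : {set 'I_c}),
  [/\ U *m V = 1%:M, V *m U = 1%:M, forall l, l \in S -> row l U *m M = 0
    & forall a : 'rV_c, a *m M = 0 -> forall l, l \notin S -> (a *m V) 0 l = 0].
Proof.
case: (int_Smith_normal_form M) => V uV [W uW [ds _ ->]].
set D := \matrix_(i, j) _.
exists (invmx V), V, [set l | row l D == 0]; split.
- exact: mulVmx.
- exact: mulmxV.
- move=> l; rewrite inE => /eqP Dl.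
  by rewrite -row_mul !mulmxA mulVmx // mul1mx row_mul Dl mul0mx.
move=> a aM l; rewrite inE => /rV0Pn[j]; rewrite !mxE => Dlj.
have aVD : a *m V *m D = 0.
  by rewrite -(mulmxK uW (a *m V *m D)) -[a *m V *m D *m W]mulmxA -mulmxA
             [V *m (D *m W)]mulmxA aM mul0mx.
have lj : l = j :> nat by apply/eqP; apply: contraNT Dlj => /negPf->; rewrite mulr0n.
have := congr1 (fun u : 'rV_d => u 0 j) aVD; rewrite mxE (bigD1 l) //= big1 => [|i il].
  by rewrite addr0 !mxE => /eqP; rewrite mulf_eq0 (negPf Dlj) orbF => /eqP.
rewrite !mxE (_ : (i == j :> nat) = false) ?mulr0n ?mulr0 //.
by rewrite -lj; apply/negbTE; apply: contraNneq il => /val_inj->.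
Qed.

Section LaurentMonomials.
Variables (F : fieldType) (n : nat) (v : 'I_n -> F).
Hypothesis nv : forall i, v i != 0.

Definition lmon (a : 'rV[int]_n) : F := \prod_i v i ^ a 0 i.

Lemma lmon_neq0 a : lmon a != 0.
Proof. by apply/prodf_neq0 => i _; rewrite expfz_neq0. Qed.

Lemma lmon0 : lmon 0 = 1.
Proof. by apply: big1 => i _; rewrite mxE expr0z. Qed.

Lemma lmonD a b : lmon (a + b) = lmon a * lmon b.
Proof. by rewrite -big_split; apply: eq_bigr => i _; rewrite mxE expfzDr. Qed.

Lemma lmonN a : lmon (- a) = (lmon a)^-1.
Proof.
by apply: (mulfI (lmon_neq0 a)); rewrite -lmonD subrr lmon0 divff ?lmon_neq0.
Qed.

Lemma lmonB a b : lmon (a - b) = lmon a / lmon b.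
Proof. by rewrite lmonD lmonN. Qed.

Lemma lmonZ z a : lmon (z *: a) = lmon a ^ z.
Proof.
rewrite /lmon; elim/big_rec2: _ => [|i x y _ ->]; first by rewrite exp1rz.
by rewrite expfzMl mxE [z * _]mulrC -exprz_exp.
Qed.

Lemma lmon_sum (I : Type) (s : seq I) (P : pred I) (a : I -> 'rV[int]_n) :
  lmon (\sum_(i <- s | P i) a i) = \prod_(i <- s | P i) lmon (a i).
Proof. by apply: big_morph; [exact: lmonD | exact: lmon0]. Qed.

Lemma lmon_delta i : lmon (delta_mx 0 i) = v i.
Proof.
rewrite /lmon (bigD1 i) //= big1 ?mulr1 => [|j ji]; rewrite mxE eqxx /=.
  by rewrite eqxx expr1z.
by rewrite (negPf ji) expr0z.
Qed.

End LaurentMonomials.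

Lemma lmon_mul (F : fieldType) (n d : nat) (v : 'I_d -> F) (M : 'M[int]_(n, d)) a :
  (forall i, v i != 0) -> lmon v (a *m M) = lmon (fun i => lmon v (row i M)) a.
Proof.
move=> nv; rewrite mulmx_sum_row lmon_sum //.
by apply: eq_bigr => i _; rewrite lmonZ.
Qed.

Definition mnm_row (n : nat) (m : 'X_{1..n}) : 'rV[int]_n := \row_i (m i)%:Z.

Lemma lmon_mnm (F : fieldType) n (v : 'I_n -> F) (m : 'X_{1..n}) :
  lmon v (mnm_row m) = \prod_i v i ^+ m i.
Proof. by apply: eq_bigr => i _; rewrite mxE exprnP. Qed.

Lemma sum_fibers (A : zmodType) (B : pzRingType) (h : {additive A -> B})
    (I W : eqType) (s : seq I) (wt : I -> W) (c : I -> A) (g : W -> B) :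
  \sum_(i <- s) h (c i) * g (wt i) =
  \sum_(b <- undup (map wt s)) h (\sum_(i <- s | wt i == b) c i) * g b.
Proof.
under [RHS]eq_bigr => b _ do rewrite raddf_sum mulr_suml.
rewrite (exchange_big_dep xpredT) //= [LHS]big_seq [RHS]big_seq; apply: eq_bigr => i si.
rewrite (big_rem (wt i)) /= ?mem_undup ?map_f // eqxx big_seq_cond big1 ?addr0 //.
by move=> b /andP[br /eqP bi]; move: br; rewrite -bi mem_rem_uniq ?undup_uniq // inE eqxx.
Qed.

(* The Newton polytopes of the factors of a monomial are points: compare the
   greatest and the least monomials of [p] and [q]. *)
Lemma monomial_factor (k : idomainType) n (p q : {mpoly k[n]}) m :
  p * q = 'X_[m] -> exists (c : k) m', p = c *: 'X_[m'].
Proof.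
move=> pq; have [np nq] : p != 0 /\ q != 0.
  apply/andP; rewrite -negb_or -mulf_eq0 pq.
  by apply/eqP => /(congr1 (mcoeff m)); rewrite mcoeffX eqxx mcoeff0 => /eqP; rewrite oner_eq0.
have mE m1 m2 : (p * q)@_(m1 + m2) = p@_m1 * q@_m2 -> p@_m1 != 0 ->
    q@_m2 != 0 -> (m1 + m2)%MM = m.
  move=> + p1 q2; rewrite pq mcoeffX; case: eqVneq => // _ /esym/eqP.
  by rewrite mulf_eq0 (negPf p1) (negPf q2).
have lead : (mlead p + mlead q)%MM = m.
  by apply: mE; rewrite ?mleadcM // mleadc_eq0.
(* The least monomial of the product comes from a single pair, all other pairs having a strictly
   larger sum. *)
have last : (mlast p + mlast q)%MM = m.
  apply: mE; rewrite -?mcoeff_msupp ?mlast_supp //.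
  rewrite mpolyME (bigD1_seq (mlast p, mlast q)) /=; first last.
  + by rewrite allpairs_uniq ?msupp_uniq // => -[? ?] [].
  + by rewrite allpairs_f // !mlast_supp.
  rewrite mcoeffD mcoeffZ mcoeffX eqxx mulr1.
  rewrite big_seq_cond raddf_sum /= big1 ?addr0 //.
  move=> _ /andP[/allpairsP[[m1 m2] /= [m1_in_p m2_in_q ->]] ne_m_lc]; rewrite mcoeffZ mcoeffX.
  move/mlast_lemc: m1_in_p; move/mlast_lemc: m2_in_q.
  rewrite le_eqVlt => /predU1P[m2E|]; last first.
    by move=> lt /lemc_lt_add /(_ lt) /gt_eqF ->; rewrite mulr0.
  move: ne_m_lc; rewrite -m2E xpair_eqE eqxx andbT.
  rewrite le_eqVlt => /negbTE; rewrite eq_sym => -> /=; rewrite eqm_add2r.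
  by move/gt_eqF=> ->; rewrite mulr0.
have eqp : mlast p = mlead p.
  have := mlast_lemc (mlead_supp np); rewrite le_eqVlt => /predU1P[//|ltp].
  have := mlast_lemc (mlead_supp nq).
  by move=> /(ltmc_le_add ltp); rewrite lead last ltxx.
exists (mleadc p), (mlead p); apply/mpolyP => m'; rewrite mcoeffZ mcoeffX.
have [<-|ne] := eqVneq; first by rewrite mulr1.
rewrite mulr0; apply/eqP; rewrite mcoeff_eq0; apply: contra ne => pm'.
by rewrite eq_le -{1}eqp mlast_lemc // msupp_le_mlead.
Qed.

Section LaurentIndependence.
Variables (k : fieldType) (d : nat).
Local Notation K := {fraction {mpoly k[d]}}.

Definition rconst (c : k) : K := tofrac c%:MP_[d].

Lemma rconst_is_zmod_morphism : zmod_morphism rconst.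
Proof. by move=> a b; rewrite /rconst mpolyCB tofracB. Qed.
HB.instance Definition _ := GRing.isZmodMorphism.Build k K rconst rconst_is_zmod_morphism.

Lemma rconst_is_monoid_morphism : monoid_morphism rconst.
Proof. by split=> [|a b]; rewrite /rconst ?mpolyC1 ?tofrac1 ?mpolyCM ?tofracM. Qed.
HB.instance Definition _ := GRing.isMonoidMorphism.Build k K rconst rconst_is_monoid_morphism.

Local Notation y := (@ratvar k d).

Lemma lmon_ratvar_mnm (m : 'X_{1..d}) : lmon y (mnm_row m) = tofrac 'X_[m].
Proof.
rewrite lmon_mnm mpolyXE_id rmorph_prod; apply: eq_bigr => i _.
by rewrite rmorphXn.
Qed.

Lemma rconst_scale c (p : {mpoly k[d]}) : rconst c * tofrac p = tofrac (c *: p).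
Proof. by rewrite -tofracM mul_mpolyC. Qed.

Lemma lmon_independent (I : eqType) (s : seq I) (wt : I -> 'rV[int]_d) (c : I -> k) :
  \sum_(i <- s) rconst (c i) * lmon y (wt i) = 0 ->
  forall b, \sum_(i <- s | wt i == b) c i = 0.
Proof.
rewrite sum_fibers; set r := undup _ => sum0 b.
have [rb|nrb] := boolP (b \in r); last first.
  rewrite big_seq_cond big1 // => i /andP[si /eqP wi].
  by case/negP: nrb; rewrite mem_undup -wi map_f.
(* [N] bounds all exponents in absolute value; multiplying by the monomial with all exponents [N]
   turns the relation into one between polynomials. *)
pose N := (\sum_(b <- r) \sum_j absz (b 0%R j))%N.
pose sh (b : 'rV[int]_d) : 'X_{1..d} := [multinom absz (b 0 j + N%:Z)%R | j < d].
have abs_le (z : int) (M : nat) : (absz z <= M)%N -> 0 <= z + M%:Z by lia.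
have shE b' : b' \in r -> mnm_row (sh b') = b' + const_mx N%:Z.
  move=> rb'; apply/rowP => j; rewrite !mxE mnmE gez0_abs //.
  have leN : (absz (b' 0%R j) <= N)%N.
    rewrite /N (big_rem b') //= (bigD1 j) //= -!addnA; exact: leq_addr.
  by apply: (abs_le _ _ leN).
have : \sum_(b <- r) (\sum_(i <- s | wt i == b) c i) *: 'X_[sh b] = 0 :> {mpoly k[d]}.
  apply/eqP; rewrite -(@tofrac_eq0 {mpoly k[d]}) rmorph_sum /=.
  have := congr1 (fun u => lmon y (const_mx N%:Z) * u) sum0.
  rewrite mulr0 mulr_sumr => S0; rewrite -[X in _ == X]S0; apply/eqP.
  rewrite [LHS]big_seq [RHS]big_seq; apply: eq_bigr => b' rb'.
  rewrite -rconst_scale -lmon_ratvar_mnm shE // lmonD; last exact: ratvar_neq0.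
  by rewrite mulrA mulrC.
move/(congr1 (mcoeff (sh b))); rewrite mcoeff0 raddf_sum /= (big_rem b) //=.
rewrite mcoeffZ mcoeffX eqxx mulr1 [X in _ + X]big1_seq ?addr0 // => b' /andP[_ rb'].
have [b'r nb'] : b' \in r /\ b' != b.
  split; first exact: mem_rem rb'.
  by apply: contraTneq rb' => ->; rewrite mem_rem_uniq ?undup_uniq // inE eqxx.
rewrite mcoeffZ mcoeffX (_ : (sh b' == sh b) = false) ?mulr0 //.
apply/negbTE; apply: contraNneq nb' => /(congr1 (@mnm_row d)).
by rewrite !shE // => /addIr->.
Qed.

End LaurentIndependence.

(** * Toric affine space *)

Lemma mul_denominators (R : comPzRingType) (s t u v : R) :
  s * t * (u + v) = t * (s * u) + s * (t * v).
Proof. by ring. Qed.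

Lemma mul_denominators_frac (R : comPzRingType) (s t w f : R) :
  t * (w * s) * f = w * (t * (s * f)).
Proof. by ring. Qed.

Lemma mul_denominators3 (R : comPzRingType) (w s t a u v : R) :
  w * s * t * (a * u + v) = t * (w * a) * (s * u) + w * s * (t * v).
Proof. by ring. Qed.

Lemma mul_denominators4 (R : comPzRingType) (s t w u v : R) :
  s * (t * u) * (w * v) = t * w * (s * (u * v)).
Proof. by ring. Qed.

Lemma mul_combination_sub (R : comPzRingType) (a t u s f g : R) :
  (a * t + u) * s - (a * f + g) = a * (t * s - f) + (u * s - g).
Proof. by ring. Qed.

Section ToricAffineSpaceTheory.
Variables (k : fieldType) (n : nat) (E : {set 'I_n}).
Local Notation P := {mpoly k[n]}.

Lemma TA_of_poly_subproof (p : P) : tofrac p \in @TA_pred k n E.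
Proof. by apply/asboolP; exists p, 0%N; rewrite expr0 divr1. Qed.

Definition TA_of_poly (p : P) : TA k n E := MkTA (TA_of_poly_subproof p).

Lemma TA_of_poly_is_zmod_morphism : zmod_morphism TA_of_poly.
Proof. by move=> p q; apply: val_inj; rewrite /= tofracB. Qed.
HB.instance Definition _ :=
  GRing.isZmodMorphism.Build P (TA k n E) TA_of_poly TA_of_poly_is_zmod_morphism.

Lemma TA_of_poly_is_monoid_morphism : monoid_morphism TA_of_poly.
Proof.
by split=> [|p q]; apply: val_inj; rewrite /= ?tofrac1 ?tofracM.
Qed.
HB.instance Definition _ :=
  GRing.isMonoidMorphism.Build P (TA k n E) TA_of_poly TA_of_poly_is_monoid_morphism.

Definition den : P := \prod_(i | i \notin E) 'X_i.

Lemma TA_repr (f : TA k n E) :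
  exists pN : P * nat, TA_of_poly den ^+ pN.2 * f = TA_of_poly pN.1.
Proof.
case: f => f fP; have /asboolP[p [N eqf]] := fP; exists (p, N).
apply: val_inj; rewrite rmorphM rmorphXn /= /den -prod_ratvarE eqf mulrC divfK //.
exact: prod_ratvar_neq0.
Qed.

Lemma TA_of_poly_inj : injective TA_of_poly.
Proof. by move=> p q /(congr1 (@TA_val _ _ _)) /eqP; rewrite tofrac_eq => /eqP. Qed.

Section Evaluation.
Variable v : 'I_n -> k.
Hypothesis nv : forall i, i \notin E -> v i != 0.

(** The value comes from a chosen fraction; by [TA_evalE] every fraction whose denominator is
    nonzero at [v] gives the same. The target [k^o] is [k] as an algebra over itself, as required
    for a point. *)
Definition TA_eval (f : TA k n E) : k^o :=
  let pN := projT1 (cid (TA_repr f)) in pN.1.@[v] / den.@[v] ^+ pN.2.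

Lemma den_eval_neq0 : den.@[v] != 0.
Proof.
rewrite /den rmorph_prod; apply/prodf_neq0 => i iE.
by rewrite /= mevalXU nv.
Qed.

Lemma TA_evalE f (p s : P) : s.@[v] != 0 ->
  TA_of_poly s * f = TA_of_poly p -> TA_eval f = p.@[v] / s.@[v].
Proof.
move=> ns sf; rewrite /TA_eval; case: cid => [[q N] /= dq].
apply/eqP; rewrite eqr_div ?expf_neq0 ?den_eval_neq0 //; apply/eqP.
rewrite -!rmorphXn -!rmorphM /=; congr (_.@[v]).
apply: TA_of_poly_inj; rewrite !rmorphM rmorphXn /= -dq -sf.
by rewrite mulrC mulrCA mulrC.
Qed.

Lemma TA_evalP f : exists p s : P,
  [/\ s.@[v] != 0, TA_of_poly s * f = TA_of_poly p & TA_eval f = p.@[v] / s.@[v]].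
Proof.
have [[p N] /= pN] := TA_repr f.
have ns : (den ^+ N).@[v] != 0 by rewrite rmorphXn expf_neq0 ?den_eval_neq0.
have sf : TA_of_poly (den ^+ N) * f = TA_of_poly p by rewrite rmorphXn.
by exists p, (den ^+ N); split=> //; apply: TA_evalE.
Qed.

Lemma TA_eval_poly p : TA_eval (TA_of_poly p) = p.@[v].
Proof.
rewrite (@TA_evalE _ p 1) ?rmorph1 ?divr1 ?oner_eq0 //.
by rewrite mul1r.
Qed.

Lemma TA_eval_is_zmod_morphism : zmod_morphism TA_eval.
Proof.
move=> f g; have [p [s [ns sf ->]]] := TA_evalP f.
have [q [t [nt tg ->]]] := TA_evalP g.
rewrite (@TA_evalE _ (t * p - s * q) (s * t)) ?mevalM ?mulf_neq0 //.
  by rewrite mevalB !mevalM; field; rewrite ns nt.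
by rewrite rmorphB !rmorphM /= -sf -tg -!mulrN mul_denominators.
Qed.
HB.instance Definition _ :=
  GRing.isZmodMorphism.Build (TA k n E) k^o TA_eval TA_eval_is_zmod_morphism.

Lemma TA_eval_is_monoid_morphism : monoid_morphism TA_eval.
Proof.
split=> [|f g]; first by rewrite -(rmorph1 TA_of_poly) TA_eval_poly meval1.
have [p [s [ns sf ->]]] := TA_evalP f.
have [q [t [nt tg ->]]] := TA_evalP g.
rewrite (@TA_evalE _ (p * q) (s * t)) ?mevalM ?mulf_neq0 //.
  by rewrite mulf_div.
by rewrite !rmorphM /= -sf -tg mulrACA.
Qed.
HB.instance Definition _ :=
  GRing.isMonoidMorphism.Build (TA k n E) k^o TA_eval TA_eval_is_monoid_morphism.

Lemma TA_eval_is_scalable : scalable TA_eval.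
Proof.
move=> c f; have -> : c *: f = TA_of_poly c%:MP * f by apply: val_inj.
by rewrite rmorphM /= TA_eval_poly mevalC.
Qed.
HB.instance Definition _ :=
  GRing.isScalable.Build k (TA k n E) k^o *:%R TA_eval TA_eval_is_scalable.

Definition TA_point : {lrmorphism TA k n E -> k^o} := TA_eval.

End Evaluation.
End ToricAffineSpaceTheory.

(** * Units and characters of the torus *)

Section TorusUnits.
Variables (k : fieldType) (d : nat).
Local Notation y := (@ratvar k d).

Lemma den_exp_mnm N : exists m, den k (set0 : {set 'I_d}) ^+ N = 'X_[m].
Proof.
by eexists; rewrite /den mprodXE mpolyXn.
Qed.

(** The numerators of a unit and of its inverse multiply to a power of the product of the variables,
    so [monomial_factor] applies. *)
Lemma torus_unit (u w : torus k d) : u * w = 1 ->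
  exists (c : k) a, TA_val u = rconst d c * lmon y a.
Proof.
move=> uw; have [[p N] /= pN] := TA_repr u; have [[q N'] /= qN] := TA_repr w.
have [m mE] := den_exp_mnm (N + N'); have [m1 m1E] := den_exp_mnm N.
have pq : p * q = 'X_[m].
  rewrite -mE; apply: (@TA_of_poly_inj k d set0).
  rewrite rmorphM rmorphXn /= -pN -qN mulrACA uw mulr1 exprD //.
have [c [m' pE]] := monomial_factor pq.
exists c, (mnm_row m' - mnm_row m1).
rewrite lmonB; last exact: ratvar_neq0.
rewrite !lmon_ratvar_mnm mulrA rconst_scale -pE -m1E.
apply: (canRL (mulfK _)).
  by rewrite m1E -lmon_ratvar_mnm lmon_neq0 //; exact: ratvar_neq0.
have := congr1 (@TA_val _ _ _) pN.
by rewrite -rmorphXn /= => <-; rewrite mulrC.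
Qed.

Lemma torus_charE (a : 'rV[int]_d) : TA_val (torus_char k a) = lmon y a.
Proof. by []. Qed.

Lemma torus_char0 : torus_char k (0 : 'rV[int]_d) = 1.
Proof. by apply: val_inj; rewrite /= -[LHS]/(lmon y 0) lmon0. Qed.

Lemma torus_charD (a b : 'rV[int]_d) :
  torus_char k (a + b) = torus_char k a * torus_char k b.
Proof. by apply: val_inj; rewrite /= -[LHS]/(lmon y (a + b)) lmonD //; exact: ratvar_neq0. Qed.

Lemma torus_char_inj : injective (@torus_char k d).
Proof.
move=> a b /(congr1 (@TA_val _ _ _)); rewrite !torus_charE => ab.
have : \sum_(i <- [:: true; false]) rconst d ((-1) ^+ i) * lmon y (if i then b else a) = 0.
  by rewrite big_cons big_seq1 /= ab -mulrDl -rmorphD /= expr1 expr0 addNr rmorph0 mul0r.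
move=> /lmon_independent /(_ b); rewrite !big_cons big_nil eqxx /=.
by case: eqP => // _; rewrite addr0 expr1 => /eqP; rewrite oppr_eq0 oner_eq0.
Qed.

End TorusUnits.

(** * Toric embeddings *)

Lemma row_split (n : nat) (a : 'rV[int]_n) : exists p q : 'X_{1..n},
  a = mnm_row p - mnm_row q /\ forall i, 0 <= a 0 i -> q i = 0%N.
Proof.
exists [multinom absz (Num.max (a 0 i) 0)%R | i < n].
exists [multinom absz (Num.min (a 0 i) 0)%R | i < n]; split=> [|i a0].
  by apply/rowP => i; rewrite !mxE !mnmE; lia.
by rewrite mnmE; lia.
Qed.

Section TorusCharacters.
Variables (k : fieldType) (n : nat).

Lemma torus_char_mnm (m : 'X_{1..n}) :
  torus_char k (mnm_row m) = TA_of_poly set0 'X_[m].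
Proof. by apply: val_inj; rewrite /= -lmon_ratvar_mnm. Qed.

Lemma rmorph_torus_char (F : fieldType) (g : {rmorphism torus k n -> F}) a :
  g (torus_char k a) = lmon (fun i => g (torus_var k i)) a.
Proof.
have nv i : g (torus_var k i) != 0.
  pose xV : torus k n := MkTA (ratvarV_TA0 k i).
  have xxV : torus_var k i * xV = 1.
    by apply: val_inj; rewrite /= divff // ratvar_neq0.
  apply/eqP => g0; have := oner_eq0 F.
  by rewrite -(rmorph1 g) -xxV rmorphM g0 mul0r eqxx.
have g_mnm m : g (torus_char k (mnm_row m)) = lmon (fun i => g (torus_var k i)) (mnm_row m).
  rewrite torus_char_mnm lmon_mnm mpolyXE_id !rmorph_prod.
  apply: eq_bigr => i _; rewrite !rmorphXn; congr (g _ ^+ _).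
  exact: val_inj.
have [p [q [-> _]]] := row_split a.
rewrite lmonB //; apply: (canRL (mulfK _)).
  by rewrite lmon_neq0.
by rewrite -!g_mnm -rmorphM -torus_charD subrK.
Qed.

End TorusCharacters.

Section ToricEmbedding.
Variables (k : fieldType) (n : nat) (E : {set 'I_n}) (d : nat) (A : comAlgType k).
Variables (pi : {lrmorphism TA k n E -> A}) (j : {lrmorphism A -> torus k d}).
Variable tau : {lrmorphism torus k n -> torus k d}.
Hypothesis hV : toric_embedding pi j tau.
Local Notation P := {mpoly k[n]}.
Local Notation y := (@ratvar k d).

(** The images of the [f i] generate the unit ideal, so some [f i] is nonzero; in the domain [A] an
    element killed by a power of it is 0. *)
Lemma toric_torus_inj a : j a = 0 -> a = 0.
Proof.
move=> ja; have tv := embedding_toric hV.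
have [m [f [[c one] inj _]]] := toric_open tv.
have [//|na] := eqVneq a 0.
have f0 i : f i = 0.
  have [N] := inj i a ja.
  move=> /(toric_integral tv) /orP[|/eqP a0]; last by rewrite a0 eqxx in na.
  elim: N => [|N IH]; first by rewrite oner_eq0.
  by rewrite exprS => /eqP/(toric_integral tv)/orP[/eqP|].
have := oner_eq0 (torus k d); rewrite one big1 ?eqxx // => i _.
by rewrite f0 rmorph0 mulr0.
Qed.

Lemma embedding_idealE (f : TA k n E) : pi f = 0 <-> tau (TA_torus f) = 0.
Proof.
rewrite (embedding_torus hV); split=> [->|/toric_torus_inj//].
by rewrite rmorph0.
Qed.

(** Restriction of polynomials to the torus of [V], with values in a field; its kernel is the
    contraction of [I(V)] to the polynomial ring. *)
Definition poly_tau (p : P) : {fraction {mpoly k[d]}} :=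
  TA_val (tau (TA_of_poly set0 p)).

Lemma poly_tau_is_zmod_morphism : zmod_morphism poly_tau.
Proof. by move=> p q; rewrite /poly_tau rmorphB rmorphB. Qed.
HB.instance Definition _ :=
  GRing.isZmodMorphism.Build P {fraction {mpoly k[d]}} poly_tau
    poly_tau_is_zmod_morphism.

Lemma poly_tau_is_monoid_morphism : monoid_morphism poly_tau.
Proof. by split=> [|p q]; rewrite /poly_tau ?rmorph1 // rmorphM rmorphM. Qed.
HB.instance Definition _ :=
  GRing.isMonoidMorphism.Build P {fraction {mpoly k[d]}} poly_tau
    poly_tau_is_monoid_morphism.

Lemma embedding_poly_idealE (p : P) : pi (TA_of_poly E p) = 0 <-> poly_tau p = 0.
Proof.
rewrite embedding_idealE.
have -> : TA_torus (TA_of_poly E p) = TA_of_poly set0 p by apply: val_inj.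
by split=> [|h]; rewrite /poly_tau; [move->|apply: val_inj].
Qed.

(* A unit of k[Z^d] is a constant times a character, and the constant is 1
   since the unit of the group T^d is mapped to that of T^n. *)
Lemma exponent_matrix : exists M : 'M[int]_(n, d),
  forall i, tau (torus_var k i) = torus_char k (row i M).
Proof.
suff /choice[r rE] : forall i, exists a, tau (torus_var k i) = torus_char k a.
  by exists (\matrix_i r i) => i; rewrite rowK.
move=> i; pose xV : torus k n := MkTA (ratvarV_TA0 k i).
have xxV : torus_var k i * xV = 1.
  by apply: val_inj; rewrite /= divff // ratvar_neq0.
have uw : tau (torus_var k i) * tau xV = 1 by rewrite -rmorphM xxV rmorph1.
have [c [a uE]] := torus_unit uw; exists a; apply: val_inj; rewrite /= uE.
suff -> : c = 1 by rewrite rmorph1 mul1r.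
have n1 (l : 'I_d) : l \notin (set0 : {set 'I_d}) -> (fun=> 1 : k) l != 0.
  by rewrite oner_eq0.
pose e : {lrmorphism torus k d -> k^o} := TA_point n1.
have e_var l : e (torus_var k l) = 1.
  have -> : torus_var k l = TA_of_poly set0 'X_l by apply: val_inj.
  by rewrite /e /= TA_eval_poly // mevalXU.
(* The unit point satisfies [e e = e], so the coordinate [c] of its image satisfies [c c = c]; and
   [c] is not 0 since [tau] preserves units. *)
have : torus_mul e e e by move=> l; rewrite !e_var mulr1.
move/(embedding_morphism hV)/(_ i) => /=.
have -> : TA_eval (fun=> 1) (tau (torus_var k i)) = c.
  have -> : tau (torus_var k i) = TA_of_poly set0 c%:MP * torus_char k a.
    by apply: val_inj; rewrite rmorphM; exact: uE.
  have := rmorph_torus_char (e : {rmorphism torus k d -> k}) a.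
  rewrite /lmon big1 => [ea|l _]; last first.
    by rewrite -[RHS](exp1rz _ (a 0 l)); congr (_ ^ _); apply: e_var.
  transitivity (e (TA_of_poly set0 c%:MP) * e (torus_char k a)); first exact: (rmorphM e).
  by rewrite [X in _ * X]ea mulr1 /= TA_eval_poly // mevalC.
move=> /eqP; rewrite -[X in X == _]mulr1 -subr_eq0 -mulrBr mulf_eq0.
have nc : c != 0.
  apply: contraTneq (oner_neq0 (torus k d)) => c0; rewrite negbK -uw.
  by rewrite (_ : tau (torus_var k i) = 0) ?mul0r //; apply: val_inj; rewrite [LHS]uE c0 rmorph0 mul0r.
by rewrite (negPf nc) subr_eq0 => /eqP.
Qed.

Variable M : 'M[int]_(n, d).
Hypothesis tauM : forall i, tau (torus_var k i) = torus_char k (row i M).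

Lemma tau_char a : tau (torus_char k a) = torus_char k (a *m M).
Proof.
apply: val_inj.
have := rmorph_torus_char ((\val : torus k d -> _) \o tau) a => /= ->.
rewrite -[RHS]/(lmon y (a *m M)) lmon_mul; last exact: ratvar_neq0.
by apply: eq_bigr => i _; rewrite tauM.
Qed.

Lemma toric_latticeE a : toric_lattice tau a <-> a *m M = 0.
Proof.
rewrite /toric_lattice tau_char -torus_char0; split=> [/torus_char_inj//|->//].
Qed.

Lemma toric_lattice_saturated : saturated (toric_lattice tau).
Proof.
move=> a; split=> [[z nz]|La]; last by exists 1; rewrite ?scale1r.
rewrite !toric_latticeE -scalemxAl => /rowP zaM; apply/rowP => i.
by have /eqP := zaM i; rewrite !mxE mulf_eq0 (negPf nz) => /eqP.
Qed.

(** The character to which the monomial [x^m] restricts on the torus of [V]. *)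
Definition weight (m : 'X_{1..n}) : 'rV[int]_d := mnm_row m *m M.

Lemma poly_tauX m : poly_tau 'X_[m] = lmon y (weight m).
Proof.
by rewrite /poly_tau -torus_char_mnm tau_char.
Qed.

Lemma poly_tauC c : poly_tau c%:MP = rconst d c.
Proof.
rewrite /poly_tau (_ : TA_of_poly set0 c%:MP = c *: 1).
  by rewrite linearZ rmorph1 /= mulr1.
by apply: val_inj; rewrite /= mulr1.
Qed.

Lemma poly_tauE p :
  poly_tau p = \sum_(m <- msupp p) rconst d p@_m * lmon y (weight m).
Proof.
rewrite {1}[p]mpolyE rmorph_sum; apply: eq_bigr => m _.
by rewrite -mul_mpolyC rmorphM /= poly_tauC poly_tauX.
Qed.

(** The form in which [I(V)] is spanned by binomials: monomials of equal weight have the same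
    restriction, and distinct characters are linearly independent. *)
Lemma poly_tau_eq0 p :
  poly_tau p = 0 <-> forall b, \sum_(m <- msupp p | weight m == b) p@_m = 0.
Proof.
rewrite poly_tauE; split; first exact: lmon_independent.
rewrite sum_fibers => p0; apply: big1 => b _.
by rewrite p0 raddf0 mul0r.
Qed.

End ToricEmbedding.

(** * The local rings of toric affine space *)

Section IdealGen.
Variables (R : comNzRingType) (m : nat).
Implicit Types (S : pred 'I_m) (y : 'I_m -> R).

Lemma ideal_gen0 S y : ideal_gen S y 0.
Proof. by exists (fun=> 0); rewrite big1 // => i _; rewrite mul0r. Qed.

Lemma ideal_genD S y u v : ideal_gen S y u -> ideal_gen S y v -> ideal_gen S y (u + v).
Proof.
move=> [c ->] [c' ->]; exists (fun i => c i + c' i).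
by rewrite -big_split; apply: eq_bigr => i _; rewrite mulrDl.
Qed.

Lemma ideal_genM S y u v : ideal_gen S y v -> ideal_gen S y (u * v).
Proof.
move=> [c ->]; exists (fun i => u * c i).
by rewrite mulr_sumr; apply: eq_bigr => i _; rewrite mulrA.
Qed.

Lemma ideal_gen_is_ideal S y : is_ideal (ideal_gen S y).
Proof. by split=> u v; [exact: ideal_genD | exact: ideal_genM]. Qed.

Lemma ideal_gen_mem S y i : S i -> ideal_gen S y (y i).
Proof.
move=> Si; exists (fun j => (j == i)%:R); rewrite (bigD1 i) //= eqxx mul1r.
by rewrite big1 ?addr0 // => l /andP[_ /negPf->]; rewrite mul0r.
Qed.

Lemma ideal_gen_sub S y (J : R -> Prop) : is_ideal J -> J 0 ->
  (forall i, S i -> J (y i)) -> forall f, ideal_gen S y f -> J f.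
Proof.
move=> idJ J0 Jy _ [c ->]; apply: is_ideal_sum => // i Si.
by apply: idJ.2; apply: Jy.
Qed.

End IdealGen.

Section LocalRingTheory.
Variables (k : fieldType) (n : nat) (E : {set 'I_n}) (xi : prime_idealr (TA k n E)).
Local Notation O := (local_ring xi).
Local Notation P := {mpoly k[n]}.
Local Notation poly := (@TA_of_poly k n E).

Lemma one_notin_prime : 1 \notin xi.
Proof. by rewrite idealr1. Qed.

Lemma loc_subproof (f : TA k n E) : TA_val f \in local_pred xi.
Proof. by apply/asboolP; exists f, 1; rewrite one_notin_prime divr1. Qed.

Definition loc (f : TA k n E) : O := MkLocal (loc_subproof f).

Lemma loc_is_zmod_morphism : zmod_morphism loc.
Proof. by move=> f g; apply: val_inj. Qed.
HB.instance Definition _ :=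
  GRing.isZmodMorphism.Build (TA k n E) O loc loc_is_zmod_morphism.

Lemma loc_is_monoid_morphism : monoid_morphism loc.
Proof. by split=> [|f g]; apply: val_inj. Qed.
HB.instance Definition _ :=
  GRing.isMonoidMorphism.Build (TA k n E) O loc loc_is_monoid_morphism.

Lemma loc_inj : injective loc.
Proof. by move=> f g /(congr1 (@local_val _ _ _ _)) fg; apply: val_inj. Qed.

Lemma loc_unit s : s \notin xi -> exists u, u * loc s = 1.
Proof.
move=> sxi; have H : (TA_val s)^-1 \in local_pred xi.
  by apply/asboolP; exists 1, s; rewrite mul1r.
by exists (MkLocal H); apply: val_inj; rewrite /= mulVf // (local_den_neq0 sxi).
Qed.

Lemma loc_frac (f : O) : exists a s, s \notin xi /\ loc s * f = loc a.
Proof.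
case: f => f fP; have /asboolP[a [s [sxi eqf]]] := fP.
exists a, s; split=> //; apply: val_inj; rewrite /= eqf mulrC divfK //.
exact: local_den_neq0 sxi.
Qed.

Lemma ideal_atP (I : TA k n E -> Prop) (f : O) :
  ideal_at I f <-> exists a s, [/\ I a, s \notin xi & loc s * f = loc a].
Proof.
split=> [[a [s [Ia sxi fE]]]|[a [s [Ia sxi fE]]]]; exists a, s; split=> //.
  by apply: val_inj; rewrite /= fE mulrC divfK // (local_den_neq0 sxi).
apply: (canRL (mulfK (local_den_neq0 sxi))).
by have := congr1 (@local_val _ _ _ _) fE; rewrite /= mulrC.
Qed.

Lemma ideal_at_loc (I : TA k n E -> Prop) a : I a -> ideal_at I (loc a).
Proof.
by move=> Ia; apply/ideal_atP; exists a, 1; rewrite one_notin_prime rmorph1 mul1r.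
Qed.

Lemma ideal_at_is_ideal (I : TA k n E -> Prop) :
  (forall u v, I u -> I v -> I (u + v)) -> (forall u v, I v -> I (u * v)) ->
  is_ideal (ideal_at (xi := xi) I).
Proof.
move=> ID IM; split=> f g; last first.
  move=> /ideal_atP[b [t [Ib txi tg]]]; have [a [s [sxi sf]]] := loc_frac f.
  apply/ideal_atP; exists (a * b), (s * t).
  by rewrite prime_idealrM negb_or sxi txi !rmorphM /= mulrACA sf tg; split=> //; apply: IM.
move=> /ideal_atP[a [s [Ia sxi sf]]] /ideal_atP[b [t [Ib txi tg]]].
apply/ideal_atP; exists (t * a + s * b), (s * t).
rewrite prime_idealrM negb_or sxi txi; split=> //; first by apply: ID; apply: IM.
by rewrite rmorphM rmorphD !rmorphM /= -sf -tg mul_denominators.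
Qed.

Definition local_max : {pred O} := fun f => `[< ideal_at (fun a => a \in xi) f >].

Lemma local_maxP f : reflect (ideal_at (fun a => a \in xi) f) (f \in local_max).
Proof. exact: asboolP. Qed.

Lemma loc_max a : (loc a \in local_max) = (a \in xi).
Proof.
apply/local_maxP/idP => [/ideal_atP[b [s [bxi sxi]]]|]; last exact: ideal_at_loc.
rewrite -rmorphM => /loc_inj sab.
by move: bxi; rewrite -sab prime_idealrM (negPf sxi).
Qed.

Lemma local_max_idealr_closed : idealr_closed local_max.
Proof.
have [ID IM] : is_ideal (ideal_at (xi := xi) (fun a => a \in xi)).
  by apply: ideal_at_is_ideal => u v; [exact: rpredD | exact: idealMr].
split; first by rewrite -(rmorph0 loc) loc_max idealr0.
  by rewrite -(rmorph1 loc) loc_max idealr1.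
move=> a u v /local_maxP um /local_maxP vm; apply/local_maxP.
by apply: ID => //; apply: IM.
Qed.

Lemma local_unit f : f \notin local_max -> exists u, u * f = 1.
Proof.
have [a [s [sxi sf]]] := loc_frac f => fm.
have axi : a \notin xi.
  by apply: contra fm => axi; apply/local_maxP/ideal_atP; exists a, s.
have [u ua] := loc_unit axi; exists (u * loc s).
by rewrite -mulrA sf.
Qed.

Lemma local_max_prime : prime_idealr_closed local_max.
Proof.
move=> u v uv; apply/orP; have [//|/local_unit[w wu]] := boolP (u \in local_max).
  by left.
by right; rewrite -[v]mul1r -wu -mulrA; apply: idealr_closedM local_max_idealr_closed _ _ uv.
Qed.

HB.instance Definition _ := isIdealr.Build O local_max local_max_idealr_closed.
HB.instance Definition _ := isPrimeIdealrClosed.Build O local_max local_max_prime.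

Definition local_maxr : prime_idealr O := local_max.

Definition residue_field : Type := {ideal_quot local_maxr}.
HB.instance Definition _ := GRing.ComNzRing.on residue_field.

Definition residue : {rmorphism O -> residue_field} := \pi_{ideal_quot local_maxr}%qT.

Lemma residue_eq0 f : (residue f == 0) = (f \in local_max).
Proof. by rewrite -(rmorph0 residue) -Quotient.idealrBE subr0. Qed.

Lemma residue_surj u : exists f, residue f = u.
Proof. by exists (repr u); exact: reprK. Qed.

Lemma residue_inv (u : residue_field) : exists v, (u != 0 -> v * u = 1) /\ (u = 0 -> v = 0).
Proof.
have [->|nu] := eqVneq u 0; first by exists 0; split; rewrite ?eqxx.
have [f fu] := residue_surj u.
have [|g gf] := @local_unit f; first by rewrite -residue_eq0 fu.
exists (residue g); split=> [_|/eqP]; last by rewrite (negPf nu).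
by rewrite -fu -rmorphM gf rmorph1.
Qed.

Definition residue_invr (u : residue_field) : residue_field := projT1 (cid (residue_inv u)).

Lemma residue_mulVf u : u != 0 -> residue_invr u * u = 1.
Proof. by move=> nu; have [/(_ nu)] := projT2 (cid (residue_inv u)). Qed.

Lemma residue_inv0 : residue_invr 0 = 0.
Proof. by have [_] := projT2 (cid (residue_inv 0)); apply. Qed.

HB.instance Definition _ :=
  GRing.ComNzRing_isField.Build residue_field residue_mulVf residue_inv0.

Definition lpoly : {rmorphism P -> O} := locked (loc \o poly : {rmorphism P -> O}).

Lemma lpolyE p : lpoly p = loc (poly p).
Proof. by rewrite /lpoly -lock. Qed.

Lemma lpoly_max p : (lpoly p \in local_max) = (poly p \in xi).
Proof. by rewrite lpolyE loc_max. Qed.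

Lemma lpoly_inj : injective lpoly.
Proof. by move=> p q; rewrite !lpolyE => /loc_inj/TA_of_poly_inj. Qed.

Lemma lpoly_unit s : poly s \notin xi -> exists u, u * lpoly s = 1.
Proof. by rewrite lpolyE; apply: loc_unit. Qed.

Lemma den_exp_notin N : poly (den k E ^+ N) \notin xi.
Proof.
have H : (TA_val (poly (den k E ^+ N)))^-1 \in @TA_pred k n E.
  by apply/asboolP; exists 1, N; rewrite tofrac1 mul1r prod_ratvarE -rmorphXn.
apply/negP => dxi; apply: (negP one_notin_prime).
have -> : 1 = MkTA H * poly (den k E ^+ N).
  by apply: val_inj; rewrite /= mulVf // tofracXn /den -prod_ratvarE prod_ratvar_neq0.
exact: idealMr.
Qed.

Lemma poly_frac a : exists p s : P, poly s \notin xi /\ poly s * a = poly p.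
Proof.
have [[p N] /= pN] := TA_repr a; exists p, (den k E ^+ N).
by rewrite den_exp_notin -pN rmorphXn.
Qed.

Lemma lpoly_frac f : exists p s : P, poly s \notin xi /\ lpoly s * f = lpoly p.
Proof.
have [a [s [sxi sf]]] := loc_frac f.
have [p [t [txi ta]]] := poly_frac a; have [q [w [wxi ws]]] := poly_frac s.
exists (w * p), (t * q); rewrite !lpolyE !rmorphM prime_idealrM negb_or txi /=.
split; first by rewrite -ws prime_idealrM negb_or wxi.
by rewrite -ws -ta !rmorphM /= -sf mul_denominators_frac.
Qed.

Lemma common_denominator m (c : 'I_m -> O) : exists (s : P) (q : 'I_m -> P),
  poly s \notin xi /\ forall l, lpoly s * c l = lpoly (q l).
Proof.
have /choice[p /choice[t pt]] := fun l => lpoly_frac (c l).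
exists (\prod_l t l), (fun l => p l * \prod_(l' | l' != l) t l'); split.
  rewrite rmorph_prod; apply: (big_ind (fun u => u \notin xi)) => [|u v uxi vxi|l _].
  - exact: one_notin_prime.
  - by rewrite prime_idealrM negb_or uxi.
  - exact: (pt l).1.
by move=> l; rewrite (bigD1 l) // (rmorphM lpoly) [RHS](rmorphM lpoly) -(pt l).2 mulrAC.
Qed.

Lemma poly_mul_notin s t : poly s \notin xi -> poly t \notin xi -> poly (s * t) \notin xi.
Proof. by move=> sxi txi; rewrite rmorphM prime_idealrM negb_or sxi. Qed.

Definition kernel_at (D : pzRingType) (phi : P -> D) (f : O) : Prop :=
  exists s g : P, [/\ poly s \notin xi, phi g = 0 & lpoly s * f = lpoly g].

Lemma kernel_at_is_ideal (D : pzRingType) (phi : {rmorphism P -> D}) :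
  is_ideal (kernel_at phi).
Proof.
split=> u v.
  move=> [s [g [sxi g0 sg]]] [t [h [txi h0 th]]]; exists (s * t), (t * g + s * h).
  split; first exact: poly_mul_notin.
    by rewrite rmorphD !rmorphM g0 h0 !mulr0 addr0.
  by rewrite (rmorphD lpoly) !(rmorphM lpoly) -sg -th mul_denominators.
move=> [s [g [sxi g0 sg]]]; have [p [t [txi tp]]] := lpoly_frac u.
exists (t * s), (p * g); split; first exact: poly_mul_notin.
  by rewrite rmorphM g0 mulr0.
by rewrite !(rmorphM lpoly) -sg -tp mulrACA.
Qed.

Lemma kernel_at0 (D : pzRingType) (phi : {rmorphism P -> D}) : kernel_at phi 0.
Proof. by exists 1, 0; rewrite (rmorph1 poly) one_notin_prime !rmorph0 mulr0. Qed.

Lemma kernel_at_lpoly (D : pzRingType) (phi : {rmorphism P -> D}) g :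
  phi g = 0 -> kernel_at phi (lpoly g).
Proof.
by move=> g0; exists 1, g; rewrite (rmorph1 poly) one_notin_prime rmorph1 mul1r.
Qed.

Lemma det_notin_max m (c : 'I_m -> 'I_m -> O) (s : 'I_m -> O) :
  (forall l l', c l l' \in local_max) -> (forall l, s l \notin local_max) ->
  \det (\matrix_(l, l') ((s l) *+ (l == l') - c l l')) \notin local_max.
Proof.
move=> cm sm; rewrite -residue_eq0 -det_map_mx.
have -> : map_mx residue (\matrix_(l, l') ((s l) *+ (l == l') - c l l'))
    = diag_mx (\row_l residue (s l)).
  apply/matrixP => l l'; rewrite !mxE rmorphB rmorphMn.
  by have /eqP-> : residue (c l l') == 0; rewrite ?residue_eq0 ?cm ?subr0.
rewrite det_diag; apply/prodf_neq0 => l _.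
by rewrite mxE residue_eq0.
Qed.

(** Modulo [J] the vector [z] is killed by the matrix [diag(s) - c]. Over the residue field this
    matrix is diagonal with nonzero entries, so its determinant is a unit and its adjugate
    concludes. *)
Lemma nakayama m (J : O -> Prop) (z : 'I_m -> O) : is_ideal J -> J 0 ->
  (forall l, exists s c, [/\ s \notin local_max, forall l', c l' \in local_max &
    J (s * z l - \sum_l' c l' * z l')]) ->
  forall l, J (z l).
Proof.
move=> idJ J0 /choice[s /choice[c sc]] l.
pose N : 'M[O]_m := \matrix_(l, l') ((s l) *+ (l == l') - c l l').
have detN : \det N \notin local_max.
  by apply: det_notin_max => [l1 l2|l1]; case: (sc l1).
have [w wdet] := local_unit detN; pose Z : 'cV[O]_m := \col_l z l.
have ZE : \det N * z l = (\adj N *m (N *m Z)) l 0.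
  by rewrite mulmxA mul_adj_mx mul_scalar_mx !mxE.
rewrite -[z l]mul1r -wdet -mulrA; apply: idJ.2; rewrite ZE mxE.
apply: is_ideal_sum => // l1 _; apply: idJ.2; have [_ _] := sc l1.
have -> // : (N *m Z) l1 0 = s l1 * z l1 - \sum_l' c l1 l' * z l'.
rewrite mxE (eq_bigr (fun l' => (s l1 * z l') *+ (l1 == l') - c l1 l' * z l')).
  rewrite sumrB; congr (_ - _).
  rewrite (bigD1 l1) //= eqxx mulr1n big1 ?addr0 => [//|l' nl].
  by rewrite eq_sym (negPf nl) mulr0n.
by move=> l' _; rewrite !mxE mulrBl mulrnAl.
Qed.

End LocalRingTheory.

(** * From transversality to the lattice *)

Section PointIdeal.
Variables (k : fieldType) (n : nat) (E : {set 'I_n}) (v : 'I_n -> k).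
Hypothesis nv : forall i, i \notin E -> v i != 0.
Local Notation P := {mpoly k[n]}.

Definition point_hom : {rmorphism TA k n E -> k} := TA_point nv.
Local Notation ev := point_hom.

Definition point_ideal : {pred TA k n E} := fun f => ev f == 0.

Lemma point_idealE f : (f \in point_ideal) = (ev f == 0).
Proof. by []. Qed.

Lemma point_ideal_closed : idealr_closed point_ideal.
Proof.
split; rewrite ?point_idealE ?rmorph0 ?rmorph1 ?oner_eq0 // => a f g.
rewrite !point_idealE => /eqP f0 /eqP g0.
by rewrite rmorphD rmorphM f0 g0 mulr0 addr0.
Qed.

Lemma point_ideal_prime : prime_idealr_closed point_ideal.
Proof. by move=> f g; rewrite !point_idealE rmorphM mulf_eq0. Qed.

HB.instance Definition _ := isIdealr.Build (TA k n E) point_ideal point_ideal_closed.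
HB.instance Definition _ :=
  isPrimeIdealrClosed.Build (TA k n E) point_ideal point_ideal_prime.

Definition point_prime : prime_idealr (TA k n E) := point_ideal.

Lemma point_poly p : ev (TA_of_poly E p) = p.@[v].
Proof. exact: TA_eval_poly. Qed.

Lemma point_prime_poly p : (TA_of_poly E p \in point_prime) = (p.@[v] == 0).
Proof. by rewrite -point_poly. Qed.

Lemma point_maximal : maximal_ideal point_prime.
Proof.
split=> [|J idJ sub f]; first exact: point_ideal_closed.
apply/idP/idP => [fJ|]; last exact: sub.
rewrite [_ \in _]point_idealE; apply/eqP; apply: contrapT => /eqP nf.
have [_ /negP J1 _] := idJ; case: J1.
pose c := TA_of_poly E (ev f)%:MP.
have cJ : c \in J.
  rewrite -[c](subKr f).
  apply: (idealr_closedD idJ) => //; apply: (idealr_closedN idJ); apply: sub.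
  by rewrite [_ \in _]point_idealE rmorphB [X in _ - X]point_poly mevalC subrr.
have -> : 1 = TA_of_poly E (ev f)^-1%:MP * c.
  by rewrite -rmorphM -mpolyCM mulVf // mpolyC1 rmorph1.
exact: idealr_closedM idJ _ _ cJ.
Qed.

(* [n] generators of the maximal ideal of a rational point have linearly
   independent differentials there. *)
Lemma parameters_relation (y c : 'I_n -> local_ring point_prime) :
  (forall f, ideal_at (fun a => a \in point_prime) f <-> ideal_gen predT y f) ->
  \sum_l c l * y l = 0 -> forall l, c l \in local_max (xi := point_prime).
Proof.
move=> gen sum0.
pose lp := lpoly point_prime.
have /choice[p /choice[s ps]] := fun l => lpoly_frac (y l).
have /choice[u us] := fun l => lpoly_unit (ps l).1.
have p0 l : (p l).@[v] = 0.
  apply/eqP; rewrite -point_prime_poly -lpoly_max -(ps l).2.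
  apply: idealMr; apply/local_maxP/gen; exact: ideal_gen_mem.
have yE l : y l = u l * lp (p l) by rewrite -(ps l).2 mulrA us mul1r.
have [T [q [Txi qE]]] := common_denominator (fun l => c l * u l).
have qp0 : \sum_l q l * p l = 0.
  apply: (@lpoly_inj _ _ _ point_prime); rewrite rmorph0 rmorph_sum.
  have := congr1 (fun z => lp T * z) sum0; rewrite mulr0 mulr_sumr => S0.
  rewrite -[RHS]S0; apply: eq_bigr => l _; by rewrite (rmorphM lp) -qE yE -!mulrA.
(* The [p l] vanish at [v], so only their own derivatives survive in the product rule. *)
have deriv (r : 'I_n -> P) j : (\sum_l r l * p l)^`M(j).@[v] =
    \sum_l (r l).@[v] * (p l)^`M(j).@[v].
  rewrite [X in X.@[v]](linear_sum (mderiv j)) raddf_sum; apply: eq_bigr => l _.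
  by rewrite /= mderivM mevalD !mevalM p0 mulr0 add0r.
(* The functions [x_i - v_i] lie in the maximal ideal; differentiating their expressions in the
   parameters shows that the Jacobian matrix [Y] is invertible. *)
have /choice[S /choice[al alE]] : forall i, exists (S : P) (al : 'I_n -> P),
    S.@[v] != 0 /\ S * ('X_i - (v i)%:MP) = \sum_l al l * p l.
  move=> i; have : ideal_gen predT y (lp ('X_i - (v i)%:MP)).
    apply/gen/local_maxP; rewrite lpoly_max point_prime_poly.
    by rewrite mevalB mevalXU mevalC subrr.
  move=> [a aE]; have [S [al [Sxi alE]]] := common_denominator (fun l => a l * u l).
  exists S, al; split; first by rewrite -point_prime_poly.
  apply: (@lpoly_inj _ _ _ point_prime); rewrite rmorphM rmorph_sum [X in _ * X]aE mulr_sumr.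
  apply: eq_bigr => l _; rewrite (rmorphM lp) -alE yE.
  by rewrite -!mulrA mulrA.
pose Y : 'M[k]_n := \matrix_(l, j) (p l)^`M(j).@[v].
pose B : 'M[k]_n := \matrix_(i, l) ((al i l).@[v] / (S i).@[v]).
have BY : B *m Y = 1%:M.
  apply/matrixP => i j; rewrite !mxE.
  have [nS /(congr1 (fun P => P^`M(j).@[v]))] := alE i.
  rewrite deriv mderivM mevalD !mevalM mevalB mevalXU mevalC subrr mulr0 add0r.
  rewrite mderivB mderivC subr0 mderivX mevalZ => eqS.
  transitivity ((S i).@[v]^-1 * \sum_l (al i l).@[v] * (p l)^`M(j).@[v]).
    by rewrite mulr_sumr; apply: eq_bigr => l _; rewrite !mxE; ring.
  rewrite -eqS mulKf // mnm1E; case: eqP => [->|_]; last by rewrite mul0r.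
  have -> : (U_(j) - U_(j) = 0)%MM by apply/mnmP => l; rewrite mnmBE mnm0E subnn.
  by rewrite mpolyX0 meval1 mulr1.
(* This is the relation itself, differentiated at [v]. *)
have qY : (\row_l (q l).@[v]) *m Y = 0.
  apply/rowP => j; rewrite !mxE -[RHS](meval0 v) -(mderiv0 _ j) -qp0 deriv.
  by apply: eq_bigr => l _; rewrite !mxE.
have q0 l : (q l).@[v] = 0.
  have := congr1 (mulmx^~ B) qY; rewrite -mulmxA (mulmx1C BY) mulmx1 mul0mx.
  by move=> /rowP/(_ l); rewrite !mxE.
move=> l; have : lp (q l) \in local_max (xi := point_prime).
  by rewrite lpoly_max point_prime_poly q0.
rewrite -qE => /local_max_prime; rewrite lpoly_max (negPf Txi) /=.
move=> /local_max_prime/orP[//|um]; have := idealr1 (local_maxr point_prime).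
by rewrite -(us l) mulrC idealMr.
Qed.

End PointIdeal.

(** * Lattice vectors nonnegative on E *)

Section SupportingOrbit.
Variables (n : nat) (E : {set 'I_n}) (d : nat) (M : 'M[int]_(n, d)).

(* The coordinates in [E] vanishing on the smallest torus orbit of [V]. *)
Definition orbit_zeros : {set 'I_n} :=
  [set h in E | ~~ `[< exists a : 'rV[int]_n, [/\ a *m M = 0, nonneg_on E a & 0 < a 0 h] >]].

Lemma orbit_zeros_sub h : h \in orbit_zeros -> h \in E.
Proof. by rewrite inE => /andP[]. Qed.

Lemma orbit_zeros_max a h : a *m M = 0 -> nonneg_on E a -> h \in orbit_zeros ->
  a 0 h = 0.
Proof.
move=> aM aE; rewrite inE => /andP[hE /asboolP nh].
apply/eqP; apply: contrapT => /negP na; apply: nh; exists a; split=> //.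
by rewrite lt_def na aE.
Qed.

(** The sum of one witness for each coordinate outside [orbit_zeros]: a relative interior point of
    the cone of lattice vectors nonnegative on [E]. *)
Lemma orbit_interior : exists a : 'rV[int]_n, [/\ a *m M = 0, nonneg_on E a &
  forall h, h \in E -> h \notin orbit_zeros -> 0 < a 0 h].
Proof.
have /choice[a aP] : forall h, exists a : 'rV[int]_n, [/\ a *m M = 0, nonneg_on E a &
    h \in E -> h \notin orbit_zeros -> 0 < a 0 h].
  move=> h; have [|nh] := pselect (exists a : 'rV[int]_n, [/\ a *m M = 0, nonneg_on E a & 0 < a 0 h]).
    by move=> [a [aM aE ah]]; exists a.
  exists 0; split=> [|l _|hE]; rewrite ?mul0mx ?mxE //.
  by rewrite inE hE /= => /negP[]; apply/asboolP.
exists (\sum_h a h); split=> [|l lE|h hE hS].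
- by rewrite mulmx_suml big1 // => h _; case: (aP h).
- by rewrite summxE sumr_ge0 // => h _; have [_ /(_ l lE)] := aP h.
rewrite summxE (bigD1 h) //= ltr_pwDl //; first by have [_ _] := aP h; apply.
by rewrite sumr_ge0 // => l _; have [_ /(_ h hE)] := aP l.
Qed.

Definition off_orbit_zeros (m : 'X_{1..n}) := [forall h in orbit_zeros, m h == 0%N].

(** Adding a large multiple of an interior vector to [m' - m] makes it nonnegative on [E], so it
    vanishes on [orbit_zeros], where [m] and the interior vector vanish too. Hence the monomials
    free of these variables fill whole weight classes. *)
Lemma off_orbit_zeros_weight m m' : weight M m = weight M m' ->
  off_orbit_zeros m -> off_orbit_zeros m'.
Proof.
move=> wm /forall_inP m0; apply/forall_inP => h hS.
have [a [aM aE apos]] := orbit_interior.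
pose N := (\sum_i m i)%N.
pose b := mnm_row m' - mnm_row m + N%:Z *: a.
have bM : b *m M = 0.
  by rewrite mulmxDl mulmxBl -[mnm_row m *m M]/(weight M m) wm subrr -scalemxAl aM scaler0 addr0.
have bE i : i \in E -> 0 <= b 0 i.
  move=> iE; rewrite !mxE; have [iS|iS] := boolP (i \in orbit_zeros).
    by rewrite (orbit_zeros_max aM aE iS) (eqP (m0 i iS)); lia.
  have leN : (m i <= N)%N by rewrite /N (bigD1 i) //= leq_addr.
  have arith (x y z : nat) (t : int) : (x <= z)%N -> 0 < t ->
      0 <= y%:Z - x%:Z + z%:Z * t by nia.
  by apply: arith leN _; apply: apos.
have := orbit_zeros_max bM bE hS.
by rewrite !mxE (orbit_zeros_max aM aE hS) (eqP (m0 h hS)); lia.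
Qed.

(* If the lattice vanishes on [orbit_zeros], a large multiple of an interior
   vector moves any basis into the orthant. *)
Lemma weak_transversal_of_orbit (L : 'rV[int]_n -> Prop) :
  (forall a, L a <-> a *m M = 0) ->
  (forall a : 'rV[int]_n, a *m M = 0 -> forall h, h \in orbit_zeros -> a 0 h = 0) ->
  weak_transversal E L.
Proof.
move=> LE L0; have [a [aM aE apos]] := orbit_interior.
have [U [V [S [UV VU US VS]]]] := kernel_adapted_basis M.
pose u l : 'rV[int]_n := if l \in S then row l U else 0.
have uM l : u l *m M = 0 by rewrite /u; case: ifP => [/US//|_]; rewrite mul0mx.
pose N := (\sum_l \sum_h absz (u l 0%R h))%N.
(* Index 0 holds [a] alone, so that the multiples of [a] added to the other generators can be taken
   back. *)
pose g (i : 'I_n.+1) := if unlift ord0 i is Some l then u l + N%:Z *: a else a.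
exists n.+1, g; split=> [i h hE|b].
  rewrite /g; case: unliftP => [l _|_]; last exact: aE.
  rewrite !mxE; have [hS|hS] := boolP (h \in orbit_zeros).
    by rewrite (L0 _ aM h hS) (L0 _ (uM l) h hS) mulr0.
  have leN : (absz (u l 0%R h) <= N)%N.
    by rewrite /N (bigD1 l) //= (bigD1 h) //= -addnA leq_addr.
  have arith (x : nat) (z t : int) : (absz z <= x)%N -> 0 < t -> 0 <= z + x%:Z * t.
    by nia.
  by apply: arith leN _; apply: apos.
rewrite LE; split=> [bM|[c ->]]; last first.
  rewrite mulmx_suml big1 // => i _; rewrite -scalemxAl /g.
  by case: unlift => [l|]; rewrite ?mulmxDl ?uM -?scalemxAl ?aM ?scaler0 ?addr0 ?scaler0.
pose c l := (b *m V) 0 l.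
have bE : b = \sum_l c l *: u l.
  rewrite -[b]mulmx1 -VU mulmxA mulmx_sum_row; apply: eq_bigr => l _.
  by rewrite /u; case: ifPn => // /(VS b bM l); rewrite /c => ->; rewrite !scale0r.
exists (fun i => if unlift ord0 i is Some l then c l else - N%:Z * \sum_l c l).
rewrite big_ord_recl /g unlift_none.
under [X in _ + X]eq_bigr => l _ do rewrite liftK scalerDr.
rewrite big_split /= -bE addrCA -[LHS]addr0; congr (_ + _).
under [X in _ + X]eq_bigr => l _ do rewrite scalerA.
by rewrite -scaler_suml -scalerDl -mulr_suml mulNr mulrC addNr scale0r.
Qed.

End SupportingOrbit.

(** * The ideal of V near the smallest orbit *)

Section TransversalLattice.
Variables (k : fieldType) (n : nat) (E : {set 'I_n}) (d : nat) (A : comAlgType k).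
Variables (pi : {lrmorphism TA k n E -> A}) (j : {lrmorphism A -> torus k d}).
Variable tau : {lrmorphism torus k n -> torus k d}.
Hypothesis hV : toric_embedding pi j tau.
Variable M : 'M[int]_(n, d).
Hypothesis tauM : forall i, tau (torus_var k i) = torus_char k (row i M).
Local Notation P := {mpoly k[n]}.
Local Notation K := {fraction {mpoly k[d]}}.
Local Notation y := (@ratvar k d).
Local Notation poly := (@TA_of_poly k n E).
Local Notation S0 := (orbit_zeros E M).
Local Notation off := (off_orbit_zeros E M).

(** [off] selects whole weight classes, and over each of them the coefficients of [p] add up to 0.
    The maps [h] and [g] leave room for three uses: restriction to the torus, the value at the orbit
    point, and [free_tau]. *)
Lemma off_sum (B : pzRingType) (h : {additive k -> B}) (g : 'rV[int]_d -> B) (p : P) :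
  poly_tau tau p = 0 ->
  \sum_(m <- msupp p | off m) h p@_m * g (weight M m) = 0.
Proof.
move/(poly_tau_eq0 tauM) => p0.
pose g' b := if `[< exists2 m, weight M m = b & off m >] then g b else 0.
rewrite big_mkcond (eq_bigr (fun m => h p@_m * g' (weight M m))) => [|m _].
  by rewrite sum_fibers big1 // => b _; rewrite p0 raddf0 mul0r.
rewrite /g'; case: asboolP => [[m' wm om']|nm].
  by rewrite (off_orbit_zeros_weight wm om').
by case: ifP => om; rewrite ?mulr0 //; case: nm; exists m.
Qed.

Definition off_part (p : P) : P := \sum_(m <- msupp p | off m) p@_m *: 'X_[m].

Lemma poly_tau_off_part p : poly_tau tau p = 0 -> poly_tau tau (off_part p) = 0.
Proof.
move=> p0; rewrite -[RHS](off_sum (rconst d) (lmon y) p0) rmorph_sum.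
apply: eq_bigr => m _; rewrite -mul_mpolyC rmorphM /=.
by rewrite poly_tauC (poly_tauX tauM).
Qed.

Definition orbit_point (h : 'I_n) : k := if h \in S0 then 0 else 1.

Lemma orbit_point_neq0 h : h \notin E -> orbit_point h != 0.
Proof.
rewrite /orbit_point; case: ifP => [/orbit_zeros_sub->//|_ _].
exact: oner_neq0.
Qed.

(** At this point the monomials selected by [off] take the value 1 and all others 0. *)
Lemma eval_orbit_point p : poly_tau tau p = 0 -> p.@[orbit_point] = 0.
Proof.
move=> p0; rewrite -[RHS](off_sum idfun (fun=> 1) p0) mevalE [RHS]big_mkcond.
apply: eq_bigr => m _; rewrite mulr1; case: ifPn => [/forall_inP om|].
  rewrite big1 ?mulr1 // => h _; rewrite /orbit_point; case: ifP => hS.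
    by rewrite (eqP (om h hS)) expr0.
  by rewrite expr1n.
rewrite negb_forall_in => /exists_inP[h hS mh].
by rewrite (bigD1 h) //= /orbit_point hS expr0n (negPf mh) mul0r mulr0.
Qed.

Local Notation xi := (point_prime orbit_point_neq0).

Lemma embedding_sub_point f : pi f = 0 -> f \in xi.
Proof.
move=> f0; have [p [s [sxi sf]]] := poly_frac xi f.
have : poly p \in xi.
  rewrite point_prime_poly eval_orbit_point //.
  by apply/(embedding_poly_idealE hV); rewrite -sf rmorphM [X in _ * X]f0 mulr0.
by rewrite -sf prime_idealrM (negPf sxi).
Qed.

Definition zero_coords (m : 'X_{1..n}) : 'X_{1..n} :=
  [multinom if i \in S0 then m i else 0%N | i < n].

(* [tau] with the coordinates in [orbit_zeros] kept free: it cuts out the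
   sublattice of the elements of the lattice vanishing there. *)
Definition free_tau : {rmorphism P -> {mpoly K[n]}} :=
  locked (mmap (@mpolyC n K \o rconst d)
    (fun i => (lmon y (row i M))%:MP * (if i \in S0 then 'X_i else 1)) :
    {rmorphism P -> {mpoly K[n]}}).

Lemma free_tauC c : free_tau c%:MP = (rconst d c)%:MP.
Proof. by rewrite /free_tau -lock /= mmapC. Qed.

Lemma free_tauM p q : free_tau (p * q) = free_tau p * free_tau q.
Proof. exact: (rmorphM free_tau). Qed.

Lemma free_tauX m : free_tau 'X_[m] = (lmon y (weight M m))%:MP * 'X_[zero_coords m].
Proof.
rewrite /free_tau -lock /= mmapX /mmap1 (eq_bigr _ (fun i _ => exprMn _ _ _)) big_split /=.
congr (_ * _).
  rewrite /weight lmon_mul; last exact: ratvar_neq0.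
  rewrite lmon_mnm rmorph_prod; apply: eq_bigr => i _; by rewrite rmorphXn.
rewrite [RHS]mpolyXE_id; apply: eq_bigr => i _; rewrite mnmE.
by case: ifP => _; rewrite ?expr1n ?expr0.
Qed.

Lemma free_tauE p : free_tau p =
  \sum_(m <- msupp p) (rconst d p@_m * lmon y (weight M m))%:MP * 'X_[zero_coords m].
Proof.
rewrite {1}[p]mpolyE rmorph_sum; apply: eq_bigr => m _.
rewrite -mul_mpolyC rmorphM free_tauX /= free_tauC mulrA.
by rewrite -(rmorphM (@mpolyC n K)).
Qed.

(** Setting the free coordinates to 1 shows that the kernel of [free_tau] lies in that of
    [poly_tau]; hence [free_tau] kills no denominator at the orbit point. *)
Lemma free_tau_eval1 p : (free_tau p).@[fun=> 1] = poly_tau tau p.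
Proof.
rewrite free_tauE raddf_sum (poly_tauE tauM); apply: eq_bigr => m _.
by rewrite /= mevalM mevalC mevalX big1 ?mulr1 // => i _; rewrite expr1n.
Qed.

(** On monomials without free variables [free_tau] only sees the weight. *)
Lemma free_tau_off_part p : poly_tau tau p = 0 -> free_tau (off_part p) = 0.
Proof.
move=> p0; rewrite rmorph_sum.
have := off_sum (@mpolyC n K \o rconst d) (fun b => (lmon y b)%:MP) p0.
move=> S0'; rewrite -[RHS]S0'; apply: eq_bigr => m /forall_inP om.
rewrite -mul_mpolyC rmorphM free_tauX /= free_tauC; congr (_ * _).
rewrite (_ : zero_coords m = 0%MM) ?mpolyX0 ?mulr1 //.
by apply/mnmP => i; rewrite mnmE mnm0E; case: ifP => // /om/eqP.
Qed.

End TransversalLattice.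

Section ForwardDirection.
Variables (k : fieldType) (n : nat) (E : {set 'I_n}) (d : nat) (A : comAlgType k).
Variables (pi : {lrmorphism TA k n E -> A}) (j : {lrmorphism A -> torus k d}).
Variable tau : {lrmorphism torus k n -> torus k d}.
Hypothesis hV : toric_embedding pi j tau.
Variable M : 'M[int]_(n, d).
Hypothesis tauM : forall i, tau (torus_var k i) = torus_char k (row i M).
Local Notation P := {mpoly k[n]}.
Local Notation poly := (@TA_of_poly k n E).
Local Notation S0 := (orbit_zeros E M).
Local Notation off := (off_orbit_zeros E M).

Local Notation xi := (point_prime (@orbit_point_neq0 k n E d M)).
Local Notation lp := (lpoly xi).

Local Notation free_ideal := (kernel_at (xi := xi) (free_tau k E M)).

Lemma free_tau_den s : poly s \notin xi -> free_tau k E M s != 0.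
Proof.
apply: contraNneq => s0; apply: (embedding_sub_point hV tauM).
by apply/(embedding_poly_idealE hV); rewrite -(free_tau_eval1 E tauM) s0 meval0.
Qed.

Hypothesis hT : geom_transversal (fun f : TA k n E => pi f = 0).

(* By transversality, [I(V)] is generated near the point of the smallest orbit
   by elements of [free_ideal] up to [xi I(V)]; conclude by Nakayama. *)
Lemma embedding_sub_free_ideal f :
  ideal_at (fun f : TA k n E => pi f = 0) f -> free_ideal f.
Proof.
have [r [z [ler [_ gen_xi] gen_I tr_E]]] :=
  hT (point_maximal _) (embedding_sub_point hV tauM).
have Jid := kernel_at_is_ideal xi (free_tau k E M).
have J0 := kernel_at0 xi (free_tau k E M).
(* The generators of [I(V)], padded with zeros so that Nakayama's lemma runs over all [n]
   indices. *)
pose z0 (l : 'I_n) := if (l < r)%N then z l else 0.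
have lp_I p : poly_tau tau p = 0 -> ideal_at (xi := xi) (fun f : TA k n E => pi f = 0) (lp p).
  by move=> p0; rewrite lpolyE; apply: ideal_at_loc;
     apply/(embedding_poly_idealE hV).
(* A monomial rejected by [off] is a multiple of some [x_h] with [h] in [orbit_zeros], and by
   transversality [x_h] is a multiple of a parameter of index at least [r]. *)
have off_gen p : ideal_gen (fun i : 'I_n => r <= i)%N z (lp (p - off_part E M p)).
  have -> : p - off_part E M p = \sum_(m <- msupp p | ~~ off m) p@_m *: 'X_[m].
    by rewrite {1}[p]mpolyE (bigID off) /= addrC addrK.
  rewrite rmorph_sum; apply: is_ideal_sum => [||m].
  - exact: ideal_gen_is_ideal.
  - exact: ideal_gen0.
  rewrite negb_forall_in => /exists_inP[h hS mh].
  have hxi : TA_var k E h \in xi.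
    have -> : TA_var k E h = poly 'X_h by apply: val_inj.
    by rewrite point_prime_poly mevalXU /orbit_point hS.
  have [i ri /(_ (lp 'X_h)) [Xi _]] := tr_E h (orbit_zeros_sub hS) hxi.
  have : ideal_gen (pred1 i) z (lp 'X_h).
    apply: Xi; have -> : lp 'X_h = loc xi (TA_var k E h) by rewrite lpolyE; apply: val_inj.
    by apply: ideal_at_loc; exists (fun=> 1); rewrite big_ord1 mul1r.
  move=> [c]; rewrite big_pred1_eq => Xc.
  have -> : 'X_[m] = 'X_[m - U_(h)] * 'X_h :> P.
    by rewrite -mpolyXD submK ?lep1mP.
  rewrite -mul_mpolyC mulrA (rmorphM lp) Xc; apply: ideal_genM; apply: ideal_genM.
  exact: ideal_gen_mem.
have step l : exists s c, [/\ s \notin local_max (xi := xi),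
    forall l', c l' \in local_max (xi := xi) &
    free_ideal (s * z0 l - \sum_l' c l' * z0 l')].
  rewrite /z0; case: ifPn => [lr|_]; last first.
    exists 1, (fun=> 0); split=> [|l'|]; rewrite ?(idealr1 (local_maxr xi)) ?(idealr0 (local_maxr xi)) //.
    by rewrite mulr0 sub0r big1 ?oppr0 // => i _; rewrite mul0r.
  have /gen_I/ideal_atP[a [t [a0 txi tz]]] : ideal_gen (fun i : 'I_n => i < r)%N z (z l).
    exact: ideal_gen_mem.
  have [p [w [wxi wa]]] := poly_frac xi a.
  have p0 : poly_tau tau p = 0.
    by apply/(embedding_poly_idealE hV); rewrite -wa rmorphM [X in _ * X]a0 mulr0.
  have o0 : poly_tau tau (off_part E M p) = 0 by exact: poly_tau_off_part.
  have : poly_tau tau (p - off_part E M p) = 0 by rewrite rmorphB [X in X - _]p0 [X in _ - X]o0 subrr.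
  move/lp_I/gen_I => [c cE]; have [e eE] := off_gen p.
  (* The two expressions of [p - off_part E M p], subtracted, form a relation between all the
     parameters. *)
  pose cc (i : 'I_n) := if (i < r)%N then c i else - e i.
  have cc0 : \sum_i cc i * z i = 0.
    rewrite (bigID (fun i : 'I_n => i < r)%N) /=.
    rewrite (eq_bigr (fun i => c i * z i)) => [|i ri]; last by rewrite /cc ri.
    rewrite -cE [X in _ + X](_ : _ = - lp (p - off_part E M p)) ?subrr //.
    rewrite eE -sumrN; apply: eq_big => i; first by rewrite -leqNgt.
    by move=> ri; rewrite /cc (negPf ri) mulNr.
  have ccm := parameters_relation gen_xi cc0.
  (* With this unit in front, [z l] becomes [p], which is congruent to [p - off_part E M p] modulo
     [free_ideal]. *)
  exists (loc xi (poly w * t)), (fun i : 'I_n => if (i < r)%N then c i else 0); split.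
  - by rewrite loc_max prime_idealrM negb_or wxi.
  - move=> i; case: ifP => ri; last exact: (idealr0 (local_maxr xi)).
    by have := ccm i; rewrite /cc ri.
  have -> : loc xi (poly w * t) * z l = lp p by rewrite rmorphM -mulrA tz lpolyE -wa rmorphM.
  have -> : \sum_(l' < n) (if (l' < r)%N then c l' else 0) * (if (l' < r)%N then z l' else 0)
      = lp (p - off_part E M p).
    rewrite cE [RHS]big_mkcond; apply: eq_bigr => i _.
    by case: ifP; rewrite ?mulr0.
  rewrite -rmorphB opprB addrC subrK; apply: kernel_at_lpoly.
  exact: free_tau_off_part.
have Jz (l : 'I_n) : (l < r)%N -> free_ideal (z l).
  by move=> lr; have := nakayama Jid J0 step l; rewrite /z0 lr.
by move/gen_I; apply: ideal_gen_sub.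
Qed.

(** For [a = p - q], [free_tau] sends [x^p - x^q] to a unit of [K] times the difference of the parts
    of [x^p] and [x^q] in the free variables. As the binomial lies in [free_ideal], these parts
    coincide. *)
Lemma lattice_zero_on_orbit (a : 'rV[int]_n) :
  a *m M = 0 -> forall h, h \in S0 -> a 0 h = 0.
Proof.
have [p [q [-> _]]] := row_split a => aM h hS.
have wpq : weight M p = weight M q.
  by apply/eqP; rewrite -subr_eq0 /weight -mulmxBl aM.
have b0 : poly_tau tau ('X_[p] - 'X_[q]) = 0.
  by rewrite rmorphB /= !(poly_tauX tauM) wpq subrr.
have : free_ideal (lp ('X_[p] - 'X_[q])).
  by apply: embedding_sub_free_ideal; rewrite lpolyE; apply: ideal_at_loc;
     apply/(embedding_poly_idealE hV).
move=> [s [g [sxi g0]]]; rewrite -(rmorphM lp) => /lpoly_inj sg.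
move: g0; rewrite -sg free_tauM => /eqP; rewrite mulf_eq0 (negPf (free_tau_den sxi)) /=.
rewrite (rmorphB (free_tau k E M)) !free_tauX wpq -mulrBr mulf_eq0 mpolyC_eq0.
rewrite (negPf (lmon_neq0 _ _)) /=; last first.
  exact: ratvar_neq0.
rewrite subr_eq0 => /eqP/(congr1 (mcoeff (zero_coords E M p))).
rewrite !mcoeffX eqxx; case: eqP => [/mnmP/(_ h)|_ /eqP]; last by rewrite oner_eq0.
by rewrite !mnmE hS !mxE => -> _; rewrite subrr.
Qed.

Lemma lattice_transversal_of_geom : lattice_transversal E (toric_lattice tau).
Proof.
split; last exact: (toric_lattice_saturated tauM).
apply: (weak_transversal_of_orbit (M := M)); first exact: toric_latticeE.
exact: lattice_zero_on_orbit.
Qed.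

End ForwardDirection.

(** * From the lattice to transversality *)

Lemma rmorph_mmap (n : nat) (k : nzRingType) (B C : comNzRingType) (g : {rmorphism B -> C})
    (f : {rmorphism k -> B}) (h : 'I_n -> B) (p : {mpoly k[n]}) :
  g (mmap f h p) = mmap (g \o f) (g \o h) p.
Proof.
rewrite /mmap rmorph_sum; apply: eq_bigr => m _.
rewrite rmorphM rmorph_prod; congr (_ * _); apply: eq_bigr => i _.
by rewrite rmorphXn.
Qed.

Lemma eq_mmap (n : nat) (k B : nzRingType) (f f' : k -> B) (h h' : 'I_n -> B)
    (p : {mpoly k[n]}) : f =1 f' -> h =1 h' -> mmap f h p = mmap f' h' p.
Proof.
move=> ff hh; apply: eq_bigr => m _; rewrite ff; congr (_ * _).
exact: mmap1_eq.
Qed.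

(** * The dimension of the local ring at a closed point *)

Section PartialEvaluation.
Variables (k : fieldType) (K : idomainType) (n : nat).
Variable phi : {rmorphism {mpoly k[n]} -> K}.

(* The kernels of these maps for [i <= n] form a chain of primes of length [n],
   strictly increasing when [phi] has algebraic image. *)
Definition partial_eval (i : nat) : {rmorphism {mpoly k[n]} -> {mpoly K[n]}} :=
  locked (mmap (@mpolyC n K \o (phi \o @mpolyC n k))
    (fun l : 'I_n => if (l < i)%N then (phi 'X_l)%:MP else 'X_l) :
    {rmorphism {mpoly k[n]} -> {mpoly K[n]}}).

Lemma partial_evalE i p : partial_eval i p =
  mmap (@mpolyC n K \o (phi \o @mpolyC n k))
    (fun l : 'I_n => if (l < i)%N then (phi 'X_l)%:MP else 'X_l) p.
Proof. by rewrite /partial_eval -lock. Qed.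

Lemma partial_evalX i (l : 'I_n) :
  partial_eval i 'X_l = if (l < i)%N then (phi 'X_l)%:MP else 'X_l.
Proof. by rewrite partial_evalE mmapX mmap1U. Qed.

Lemma partial_evalC i c : partial_eval i c%:MP = (phi c%:MP)%:MP.
Proof. by rewrite partial_evalE mmapC. Qed.

(** Evaluating the remaining variables gives back [phi], so all these kernels lie in that of [phi];
    for the residue map at [xi] they therefore survive localization. *)
Lemma partial_eval_eval i p : (partial_eval i p).@[fun l => phi 'X_l] = phi p.
Proof.
rewrite partial_evalE (rmorph_mmap (meval _)).
have -> : phi p = mmap (phi \o @mpolyC n k) (fun l => phi 'X_l) p.
  rewrite {1}[p]mpolyE rmorph_sum /mmap; apply: eq_bigr => m _.
  rewrite -mul_mpolyC rmorphM; congr (_ * _).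
  by rewrite mpolyXE_id rmorph_prod; apply: eq_bigr => l _; rewrite rmorphXn.
apply: eq_mmap => [c|l] /=; first by rewrite mevalC.
by case: ifP => _; rewrite ?mevalC ?mevalXU.
Qed.

Lemma partial_evalS i p : partial_eval i p = 0 -> partial_eval i.+1 p = 0.
Proof.
move=> p0; pose h (l : 'I_n) : {mpoly K[n]} :=
  if l == i :> nat then (phi 'X_l)%:MP else 'X_l.
have <- : mmap (@mpolyC n K) h (partial_eval i p) = partial_eval i.+1 p; last by rewrite p0 mmap0.
rewrite !partial_evalE (rmorph_mmap (mmap (@mpolyC n K) h)).
apply: eq_mmap => [c|l] /=; first by rewrite mmapC.
have [li|] := ltnP l i; first by rewrite (ltn_trans li) // mmapC.
rewrite mmapX mmap1U /h leq_eqVlt => /orP[/eqP il|il]; first by rewrite -il ltnSn eqxx.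
by rewrite gtn_eqF // ltnS leqNgt il.
Qed.

(** The equation [q] of [phi 'X_l], taken at the variable ['X_l], dies when this variable is
    evaluated and not before. *)
Lemma partial_eval_separates (l : 'I_n) :
  (exists2 q : {poly k}, q != 0 & (map_poly (phi \o @mpolyC n k) q).[phi 'X_l] = 0) ->
  exists2 p, partial_eval l.+1 p = 0 & partial_eval l p != 0.
Proof.
move=> [q nq q0]; pose p := (map_poly (@mpolyC n k) q).['X_l].
have pE j : partial_eval j p = (map_poly (@mpolyC n K)
    (map_poly (phi \o @mpolyC n k) q)).[partial_eval j 'X_l].
  rewrite /p -horner_map -!map_poly_comp; congr (_.[_]).
  by apply: eq_map_poly => c; rewrite /= partial_evalC.
exists p; rewrite pE partial_evalX.
  by rewrite ltnSn horner_map [X in _ X = _]q0 raddf0.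
(* Sending every variable to the single ['X] recovers [q], with coefficients in [K], from its value
   at ['X_l]. *)
pose g : {rmorphism {mpoly K[n]} -> {poly K}} := mmap (@polyC K) (fun=> 'X).
rewrite ltnn; apply: contra_neq nq => /(congr1 g).
rewrite rmorph0 -(horner_map g) -map_poly_comp /= mmapX mmap1U.
have -> : map_poly (g \o @mpolyC n K) (map_poly (phi \o @mpolyC n k) q)
   = map_poly polyC (map_poly (phi \o @mpolyC n k) q).
  by apply: eq_map_poly => c; rewrite /= mmapC.
rewrite -[LHS]/(_ \Po 'X) comp_polyXr => /eqP; rewrite map_poly_eq0 => /eqP//.
Qed.

End PartialEvaluation.

Section MaximalIdeal.
Variables (k : fieldType) (n : nat) (E : {set 'I_n}) (xi : prime_idealr (TA k n E)).
Hypothesis max_xi : maximal_ideal xi.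
Local Notation O := (local_ring xi).
Local Notation poly := (@TA_of_poly k n E).
Local Notation lp := (lpoly xi).
Local Notation K := (residue_field xi).

Lemma maximal_inverse s : s \notin xi -> exists t, t * s - 1 \in xi.
Proof.
move=> sxi; apply: contrapT => nt.
pose J : {pred TA k n E} := fun f => `[< exists t, t * s - f \in xi >].
have JP f : reflect (exists t, t * s - f \in xi) (f \in J) by apply: asboolP.
have xiJ : {subset xi <= J}.
  by move=> f fxi; apply/JP; exists 0; rewrite mul0r sub0r rpredN.
have idJ : idealr_closed J.
  split; first by apply: xiJ; apply: idealr0.
    by apply/JP.
  move=> a f g /JP[t tf] /JP[u ug]; apply/JP; exists (a * t + u).
  by rewrite mul_combination_sub rpredD // idealMr.
have := max_xi.2 J idJ xiJ s; rewrite (negPf sxi) => /negP[]; apply/JP.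
by exists 1; rewrite mul1r subrr idealr0.
Qed.

Definition loc_const : {rmorphism k -> O} := lp \o (@mpolyC n k).

(** Since [xi] is maximal, denominators are invertible modulo [xi] inside the coordinate ring. So
    the residue field is generated over [k] by the residues of the coordinates and of the inverse of
    [den], and Zariski's lemma applies. *)
Lemma residue_algebraic (u : K) : exists2 p : {poly k}, p != 0 &
  (map_poly (residue xi \o loc_const) p).[u] = 0.
Proof.
have H : (TA_val (poly (den k E)))^-1 \in @TA_pred k n E.
  by apply/asboolP; exists 1, 1%N; rewrite tofrac1 mul1r expr1 prod_ratvarE.
pose dinv := MkTA H.
have dinvM : dinv * poly (den k E) = 1.
  apply: val_inj; rewrite /= mulVf // /den -prod_ratvarE.
  by have := prod_ratvar_neq0 k (fun i => i \notin E) 1; rewrite expr1.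
pose res (a : TA k n E) : K := residue xi (loc xi a).
pose s := res dinv :: [seq res (poly 'X_i) | i <- enum 'I_n].
apply: (@zariski K k (residue xi \o loc_const) s) => [v nv|].
  by exists v^-1; rewrite divff.
move=> w S Sk Ss SD SM.
have Sexp v N : S v -> S (v ^+ N).
  move=> Sv; elim: N => [|N IH]; last by rewrite exprS; apply: SM.
  by rewrite expr0 -(rmorph1 (residue xi \o loc_const)); apply: Sk.
have S0 : S 0 by rewrite -(rmorph0 (residue xi \o loc_const)); apply: Sk.
have S1 : S 1 by rewrite -(rmorph1 (residue xi \o loc_const)); apply: Sk.
have Sp p : S (res (poly p)).
  rewrite /res -lpolyE [p]mpolyE !rmorph_sum; apply: (big_ind S) => // m _.
  rewrite -mul_mpolyC !rmorphM; apply: (SM); first exact: Sk.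
  rewrite mpolyXE_id !rmorph_prod; apply: (big_ind S) => [|v1 v2|i _]; [exact: S1 | exact: SM |].
  rewrite !rmorphXn /= lpolyE; apply: (Sexp); apply: (Ss); rewrite inE; apply/orP; right.
  by apply/mapP; exists i; rewrite ?mem_enum.
have Sa a : S (res a).
  have [[p N] /= pN] := TA_repr a.
  have -> : a = dinv ^+ N * poly p by rewrite -pN mulrA -exprMn dinvM expr1n mul1r.
  rewrite /res !rmorphM !rmorphXn; apply: (SM); last exact: Sp.
  by apply: (Sexp); apply: (Ss); rewrite inE eqxx.
have [f fw] := residue_surj w; have [a [t [txi ta]]] := loc_frac f.
have [t' t't] := maximal_inverse txi.
suff -> : w = res (t' * a) by apply: Sa.
have e1 : loc xi (t' * a) = loc xi (t' * t) * f by rewrite !rmorphM -mulrA ta.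
have e2 : residue xi (loc xi (t' * t)) = 1.
  by apply/eqP; rewrite -subr_eq0; move: t't; rewrite -loc_max -residue_eq0 !rmorphB !rmorph1.
by rewrite /res e1 (rmorphM (residue xi)) e2 mul1r fw.
Qed.

Section PartialResidue.
Variable i : nat.
Local Notation partial_residue := (partial_eval (residue xi \o lp) i).

Lemma partial_residue_neq0 s : poly s \notin xi -> partial_residue s != 0.
Proof.
apply: contraNneq => s0; rewrite -lpoly_max -residue_eq0.
by rewrite -[residue xi (lp s)](partial_eval_eval (residue xi \o lp) i) s0 meval0.
Qed.

Definition partial_ideal : {pred O} := fun f =>
  `[< exists p s, [/\ poly s \notin xi, lp s * f = lp p & partial_residue p = 0] >].

Lemma partial_idealP f : reflect
  (exists p s, [/\ poly s \notin xi, lp s * f = lp p & partial_residue p = 0])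
  (f \in partial_ideal).
Proof. exact: asboolP. Qed.

Lemma partial_ideal_poly p : (lp p \in partial_ideal) = (partial_residue p == 0).
Proof.
apply/partial_idealP/eqP => [[q [s [sxi sp q0]]]|p0]; last first.
  by exists p, 1; rewrite rmorph1 one_notin_prime rmorph1 mul1r.
have := q0; rewrite -(lpoly_inj (etrans (rmorphM lp s p) sp)) rmorphM => /eqP.
by rewrite mulf_eq0 (negPf (partial_residue_neq0 sxi)) => /eqP.
Qed.

Lemma partial_ideal_prime : prime_ideal partial_ideal.
Proof.
split; first split.
- by rewrite -(rmorph0 lp) partial_ideal_poly rmorph0.
- by rewrite -(rmorph1 lp) partial_ideal_poly rmorph1 oner_eq0.
- move=> a u v /partial_idealP[p [s [sxi su p0]]] /partial_idealP[q [t [txi tv q0]]].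
  have [b [w [wxi wa]]] := lpoly_frac a.
  apply/partial_idealP; exists (t * b * p + w * s * q), (w * s * t).
  rewrite !rmorphM !prime_idealrM !negb_or sxi txi wxi; split=> //; last first.
    by rewrite rmorphD !(rmorphM partial_residue) p0 q0 !mulr0 addr0.
  by rewrite (rmorphD lp) !(rmorphM lp) -wa -su -tv mul_denominators3.
move=> u v /partial_idealP[p [s [sxi suv p0]]].
have [p1 [s1 [s1xi su]]] := lpoly_frac u; have [p2 [s2 [s2xi sv]]] := lpoly_frac v.
have : partial_residue (s * p1 * p2) = 0.
  rewrite (_ : s * p1 * p2 = s1 * s2 * p) ?(rmorphM partial_residue) ?p0 ?mulr0 //.
  by apply: (@lpoly_inj _ _ _ xi); rewrite !(rmorphM lp) -su -sv -suv mul_denominators4.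
rewrite !(rmorphM partial_residue) => /eqP; rewrite !mulf_eq0 (negPf (partial_residue_neq0 sxi)) /=.
by case/orP=> /eqP z0; apply/orP; [left|right]; apply/partial_idealP; [exists p1, s1|exists p2, s2].
Qed.

End PartialResidue.

Lemma krull_dim_local : krull_dim O n.
Proof.
split=> [|l Q]; last first.
  apply: (@prime_chain_leq k n O lp) => f; have [p [s [sxi sf]]] := lpoly_frac f.
  by have [u us] := lpoly_unit sxi; exists p, s, u.
exists partial_ideal; split=> [i _|i ltin]; first exact: partial_ideal_prime.
split=> [f /partial_idealP[p [s [sxi sf p0]]]|].
  by apply/(partial_idealP i.+1); exists p, s; split; [exact: sxi | exact: sf | exact: (partial_evalS p0)].
have [|p p0 np] := @partial_eval_separates k K n (residue xi \o lp) (Ordinal ltin).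
  exact: residue_algebraic.
rewrite /= in p0 np; exists (lp p).
  by rewrite (partial_ideal_poly i.+1); apply/eqP.
by rewrite (partial_ideal_poly i).
Qed.

End MaximalIdeal.

(** * Monomials that are units at a point *)

Section UnitMonomials.
Variables (k : fieldType) (n : nat) (E : {set 'I_n}) (xi : prime_idealr (TA k n E)).
Local Notation O := (local_ring xi).
Local Notation P := {mpoly k[n]}.
Local Notation poly := (@TA_of_poly k n E).
Local Notation lp := (lpoly xi).
Local Notation x := (@ratvar k n).
Local Notation m_xi := (local_max (xi := xi)).

Definition zeros_at : {set 'I_n} := [set h | poly 'X_h \in xi].

Lemma zeros_at_sub h : h \in zeros_at -> h \in E.
Proof.
rewrite inE => hxi; apply: contraT => hE; have := den_exp_notin xi 1.
by rewrite expr1 /den (bigD1 h) //= rmorphM prime_idealrM hxi.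
Qed.

Lemma monomial_notin (p : 'X_{1..n}) : (forall h, h \in zeros_at -> p h = 0%N) ->
  poly 'X_[p] \notin xi.
Proof.
move=> p0; rewrite mpolyXE_id rmorph_prod.
apply: (big_ind (fun u => u \notin xi)) => [|u v uxi vxi|i _].
- exact: one_notin_prime.
- by rewrite prime_idealrM negb_or uxi.
have [iZ|iZ] := boolP (i \in zeros_at); first by rewrite p0 // expr0 rmorph1 one_notin_prime.
rewrite inE in iZ; elim: (p i) => [|e IH]; first by rewrite expr0 rmorph1 one_notin_prime.
by rewrite exprS rmorphM prime_idealrM negb_or iZ.
Qed.

Lemma lpoly_val p : local_val (lp p) = tofrac p.
Proof. by rewrite lpolyE. Qed.

Lemma unit_character (b : 'rV[int]_n) : (forall h, h \in zeros_at -> b 0 h = 0) ->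
  exists f : O, local_val f = lmon x b /\ f \notin m_xi.
Proof.
have [p [q [-> q0]]] := row_split b => b0.
have q0' h : h \in zeros_at -> q h = 0%N by move=> hZ; apply: q0; rewrite b0.
have p0' h : h \in zeros_at -> p h = 0%N.
  by move=> hZ; have := b0 h hZ; rewrite !mxE (q0' h hZ) subr0 => -[].
have [u uq] := lpoly_unit (monomial_notin q0'); exists (u * lp 'X_[p]); split.
  rewrite /= lpoly_val lmonB; last exact: ratvar_neq0.
  rewrite !lmon_ratvar_mnm mulrC; congr (_ * _).
  have nq : tofrac ('X_[q] : P) != 0.
    by rewrite -lmon_ratvar_mnm lmon_neq0 //; exact: ratvar_neq0.
  apply: (mulIf nq); rewrite mulVf //.
  by have := congr1 (@local_val _ _ _ _) uq; rewrite /= lpoly_val.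
apply/negP => /local_max_prime/orP[um|]; last first.
  by rewrite lpoly_max (negPf (monomial_notin p0')).
have := idealr_closedM (local_max_idealr_closed xi) (lp 'X_[q]) um.
by rewrite mulrC uq (negPf (_ : 1 \notin m_xi)) //; case: (local_max_idealr_closed xi).
Qed.

Variables (c d : nat) (M : 'M[int]_(n, d)) (B : 'M[int]_(c, n)).
Hypothesis B_surj : forall b : 'rV[int]_n, (forall h, h \in zeros_at -> b 0 h = 0) ->
  exists a, b = a *m B.
Variable F : 'rV[int]_c -> O.
Hypothesis FE : forall a, local_val (F a) = lmon x (a *m B).
Hypothesis Fm : forall a, F a \notin m_xi.

Lemma unit_char0 : F 0 = 1.
Proof. by apply: val_inj; rewrite /= FE mul0mx lmon0. Qed.

Lemma unit_charD a b : F (a + b) = F a * F b.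
Proof.
by apply: val_inj; rewrite /= !FE mulmxDl lmonD //; exact: ratvar_neq0.
Qed.

Lemma unit_charN a : F (- a) * F a = 1.
Proof. by rewrite -unit_charD addNr unit_char0. Qed.

(** Used for two subgroups: the exponents [a] with [F a] congruent to 1 modulo [J], and those with
    [F a] in [gen_frac]. *)
Lemma basis_subgroup (U V : 'M[int]_c) (T : 'rV[int]_c -> Prop) a :
  V *m U = 1%:M -> T 0 -> (forall u v, T u -> T v -> T (u + v)) ->
  (forall u, T u -> T (- u)) -> (forall l, (a *m V) 0 l = 0 \/ T (row l U)) -> T a.
Proof.
move=> VU T0 TD TN Tl.
have Tn u N : T u -> T (N%:Z *: u).
  move=> Tu; elim: N => [|N IH]; first by rewrite scale0r.
  by rewrite intS scalerDl scale1r; apply: TD.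
have Tz u z : T u -> T (z *: u).
  by move=> Tu; case: z => N; [|rewrite NegzE scaleNr; apply: TN]; apply: Tn.
rewrite -[a]mulmx1 -VU mulmxA mulmx_sum_row; apply: (big_ind T) => // l _.
by case: (Tl l) => [->|Tu]; [rewrite scale0r | apply: Tz].
Qed.

Variables (U V : 'M[int]_c) (S : {set 'I_c}).
Hypothesis VU : V *m U = 1%:M.
Hypothesis VS : forall a : 'rV_c, a *m (B *m M) = 0 -> forall l, l \notin S -> (a *m V) 0 l = 0.
Variable J : O -> Prop.
Hypotheses (idJ : is_ideal J) (J0 : J 0).
Hypothesis JS : forall l, l \in S -> J (F (row l U) - 1).

Lemma kernel_char_sub1 a : a *m (B *m M) = 0 -> J (F a - 1).
Proof.
move=> aM; apply: (@basis_subgroup U V (fun a => J (F a - 1)) a) => //.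
- by rewrite unit_char0 subrr.
- move=> u v Ju Jv; rewrite unit_charD.
  have -> : F u * F v - 1 = F v * (F u - 1) + (F v - 1) by rewrite mulrBr mulr1 mulrC addrA subrK.
  by apply: idJ.1 => //; apply: idJ.2.
- move=> u Ju; have -> : F (- u) - 1 = - F (- u) * (F u - 1).
    by rewrite mulrBr mulr1 mulNr unit_charN opprK addrC.
  exact: idJ.2.
by move=> l; have [/JS|/(VS aM)] := boolP (l \in S); [right | left].
Qed.

Hypothesis M_zeros : forall b : 'rV[int]_n, b *m M = 0 -> forall h, h \in zeros_at -> b 0 h = 0.

(** The exponent [m - m'] is killed by [M], hence vanishes on the zeros at [xi]; so the quotient of
    the two monomials is a unit [F a], congruent to 1 modulo [J]. *)
Lemma monomial_congr m m' : weight M m = weight M m' -> J (lp 'X_[m] - lp 'X_[m']).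
Proof.
move=> wm; pose b := mnm_row m - mnm_row m'.
have bM : b *m M = 0 by rewrite mulmxBl -/(weight M m) wm subrr.
have [a ba] := B_surj (M_zeros bM).
have -> : lp 'X_[m] = F a * lp 'X_[m'].
  apply: val_inj; rewrite /= !lpoly_val FE -ba -!lmon_ratvar_mnm -lmonD ?subrK //.
  exact: ratvar_neq0.
rewrite -[X in _ - X]mul1r -mulrBl mulrC; apply: idJ.2; apply: kernel_char_sub1.
by rewrite mulmxA -ba.
Qed.

(** Modulo [J] each monomial equals a representative [R b] chosen for its weight [b], and the
    coefficients in front of each [R b] add up to 0. *)
Lemma kernel_poly_sub (p : P) :
  (forall b, \sum_(m <- msupp p | weight M m == b) p@_m = 0) -> J (lp p).
Proof.
move=> p0; have /choice[R RP] : forall b, exists R : O, forall m, weight M m = b -> J (lp 'X_[m] - R).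
  move=> b; have [[m wm]|nm] := pselect (exists m, weight M m = b); last first.
    by exists 0 => m wm; case: nm; exists m.
  by exists (lp 'X_[m]) => m' wm'; apply: monomial_congr; rewrite wm wm'.
have lpE : lp p = \sum_(m <- msupp p) loc_const xi p@_m * (lp 'X_[m] - R (weight M m))
    + \sum_(m <- msupp p) loc_const xi p@_m * R (weight M m).
  rewrite -big_split {1}[p]mpolyE rmorph_sum; apply: eq_bigr => m _.
  by rewrite /= -mulrDr subrK -mul_mpolyC rmorphM.
rewrite lpE sum_fibers [X in _ + X]big1 ?addr0; last first.
  by move=> b _; rewrite p0 raddf0 mul0r.
by apply: is_ideal_sum => // m _; apply: idJ.2; apply: RP.
Qed.

Variable ws : seq O.
Hypothesis wsU : forall l, F (row l U) \in ws.
Hypothesis wsZ : forall h, h \in zeros_at -> lp 'X_h \in ws.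
Local Notation gen := (adjoined (loc_const xi) ws).

(** [triangular_generators] controls only the subalgebra generated by [ws]. Fractions with unit
    denominators reach the inverses of the [F a], and with them the whole local ring. *)
Definition gen_frac (f : O) : Prop := exists v g, [/\ gen v, gen g, v \notin m_xi & v * f = g].

Lemma max_mul u v : u \notin m_xi -> v \notin m_xi -> u * v \notin m_xi.
Proof. by move=> um vm; apply/negP => /local_max_prime; rewrite (negPf um) (negPf vm). Qed.

Lemma gen_frac_gen f : gen f -> gen_frac f.
Proof.
move=> gf; exists 1, f; split; rewrite ?mul1r //; first exact: adjoined1.
by rewrite (idealr1 (local_maxr xi)).
Qed.

Lemma gen_frac1 : gen_frac 1.
Proof. by apply: gen_frac_gen; apply: adjoined1. Qed.

Lemma gen_fracM f g : gen_frac f -> gen_frac g -> gen_frac (f * g).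
Proof.
move=> [v [f' [gv gf' vm vf]]] [w [g' [gw gg' wm wg]]]; exists (v * w), (f' * g').
by split; [exact: adjoinedM | exact: adjoinedM | exact: max_mul | rewrite mulrACA vf wg].
Qed.

Lemma gen_fracD f g : gen_frac f -> gen_frac g -> gen_frac (f + g).
Proof.
move=> [v [f' [gv gf' vm vf]]] [w [g' [gw gg' wm wg]]]; exists (v * w), (w * f' + v * g').
split; [exact: adjoinedM | by apply: adjoinedD; apply: adjoinedM | exact: max_mul |].
by rewrite mul_denominators vf wg.
Qed.

Lemma gen_frac_div f g : gen_frac f -> gen_frac g -> f \notin m_xi -> forall h, f * h = g -> gen_frac h.
Proof.
move=> [v [f' [gv gf' vm vf]]] [w [g' [gw gg' wm wg]]] fm h fh.
exists (w * f'), (v * g'); split; [exact: adjoinedM | exact: adjoinedM | |].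
  by rewrite -vf; apply: max_mul => //; apply: max_mul.
by rewrite -vf -wg -fh -!mulrA [RHS]mulrCA.
Qed.

Lemma gen_frac_char a : gen_frac (F a).
Proof.
apply: (@basis_subgroup U V (fun a => gen_frac (F a)) a) => //.
- by rewrite unit_char0; apply: gen_frac1.
- by move=> u v gu gv; rewrite unit_charD; apply: gen_fracM.
- move=> u gu; apply: (gen_frac_div gu gen_frac1) => //.
  by rewrite mulrC unit_charN.
by move=> l; right; apply: gen_frac_gen => T _ Ts _ _; apply: Ts.
Qed.

Lemma gen_frac_poly p : gen_frac (lp p).
Proof.
have gX i : gen_frac (lp 'X_i).
  have [iZ|iZ] := boolP (i \in zeros_at).
    by apply: gen_frac_gen => T _ Ts _ _; apply: Ts; apply: wsZ.
  have [h hZ|a ba] := @B_surj (delta_mx 0 i).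
    by rewrite mxE eqxx; case: eqP => // hi; rewrite hi (negPf iZ) in hZ.
  have -> : lp 'X_i = F a; last exact: gen_frac_char.
  by apply: val_inj; rewrite /= lpoly_val FE -ba lmon_delta.
have g1 := gen_frac1.
have gC c0 : gen_frac (loc_const xi c0).
  by apply: gen_frac_gen => T Tk _ _ _; apply: Tk.
rewrite [p]mpolyE rmorph_sum; apply: (big_ind gen_frac) => [||m _].
- by rewrite -(rmorph0 (loc_const xi)); apply: gC.
- exact: gen_fracD.
rewrite -mul_mpolyC rmorphM; apply: gen_fracM; first exact: gC.
rewrite mpolyXE_id rmorph_prod; apply: (big_ind gen_frac) => [//||i _]; first exact: gen_fracM.
rewrite rmorphXn; elim: (m i) => [//|e IH]; rewrite exprS; exact: gen_fracM.
Qed.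

Lemma gen_frac_all f : gen_frac f.
Proof.
have [p [s [sxi sf]]] := lpoly_frac f.
by apply: (gen_frac_div (gen_frac_poly s) (gen_frac_poly p)); rewrite ?lpoly_max.
Qed.

End UnitMonomials.

Section ClosedPoint.
Variables (k : fieldType) (n : nat) (E : {set 'I_n}) (d : nat) (A : comAlgType k).
Variables (pi : {lrmorphism TA k n E -> A}) (j : {lrmorphism A -> torus k d}).
Variable tau : {lrmorphism torus k n -> torus k d}.
Hypothesis hV : toric_embedding pi j tau.
Variable M : 'M[int]_(n, d).
Hypothesis tauM : forall i, tau (torus_var k i) = torus_char k (row i M).
Variable xi : prime_idealr (TA k n E).
Hypothesis pi_xi : forall f, pi f = 0 -> f \in xi.
Local Notation O := (local_ring xi).
Local Notation poly := (@TA_of_poly k n E).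
Local Notation x := (@ratvar k n).
Local Notation I_xi := (ideal_at (xi := xi) (fun f => pi f = 0)).

Lemma pi_binomial p q : weight M p = weight M q -> pi (poly ('X_[p] - 'X_[q])) = 0.
Proof.
by move=> wpq; apply/(embedding_poly_idealE hV); rewrite rmorphB /= !(poly_tauX tauM) wpq subrr.
Qed.

Lemma weight_eq (p q : 'X_{1..n}) : (mnm_row p - mnm_row q) *m M = 0 -> weight M p = weight M q.
Proof. by rewrite mulmxBl => /eqP; rewrite subr_eq0 => /eqP. Qed.

(** For a generator [p - q] nonnegative on [E], [q] avoids [E], so [x^q] is nonzero at [xi]. So is
    [x^p], which has the same residue; hence [p] vanishes at every coordinate that is 0 at [xi]. *)
Lemma lattice_zero_at : weak_transversal E (toric_lattice tau) ->
  forall a : 'rV[int]_n, a *m M = 0 -> forall h, h \in zeros_at xi -> a 0 h = 0.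
Proof.
move=> [l [gen [gen_ge0 genL]]] a /(toric_latticeE tauM)/genL[cc ->] h hZ.
rewrite summxE big1 // => i _; rewrite mxE.
have [p [q [gE q0]]] := row_split (gen i).
have q0' h' : h' \in zeros_at xi -> q h' = 0%N.
  by move/zeros_at_sub => h'E; apply: q0; apply: gen_ge0.
have wpq : weight M p = weight M q.
  apply: weight_eq; rewrite -gE; apply/(toric_latticeE tauM)/genL.
  exists (fun i' => (i' == i)%:R); rewrite (bigD1 i) //= eqxx scale1r big1 ?addr0 // => i' /negPf->.
  by rewrite scale0r.
have pxi : poly 'X_[p] \notin xi.
  apply: contra (monomial_notin q0') => pxi.
  by rewrite -[poly 'X_[q]](subKr (poly 'X_[p])) rpredB // -rmorphB; apply: pi_xi; apply: pi_binomial.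
rewrite gE !mxE q0' // subr0; case: (posnP (p h)) => [->|ph]; first by rewrite mulr0.
move: pxi; have /submK <- : (U_(h) <= p)%MM by rewrite lep1mP -lt0n.
by rewrite mpolyXD rmorphM idealMr //; rewrite inE in hZ.
Qed.

Variables (c : nat) (B : 'M[int]_(c, n)) (F : 'rV[int]_c -> O).
Hypothesis FE : forall a, local_val (F a) = lmon x (a *m B).
Hypothesis B0 : forall (a : 'rV[int]_c) h, h \in zeros_at xi -> (a *m B) 0 h = 0.

Lemma unit_char_sub1 a : a *m (B *m M) = 0 -> I_xi (F a - 1).
Proof.
have [p [q [aE q0]]] := row_split (a *m B); rewrite mulmxA aE => /weight_eq wpq.
have q0' h : h \in zeros_at xi -> q h = 0%N by move=> hZ; apply: q0; rewrite B0.
apply/ideal_atP; exists (poly ('X_[p] - 'X_[q])), (poly 'X_[q]); split.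
- exact: pi_binomial.
- exact: monomial_notin.
have nx i : x i != 0 by exact: ratvar_neq0.
rewrite -!lpolyE; apply: val_inj; rewrite /= !lpoly_val FE aE tofracB -!lmon_ratvar_mnm lmonB //.
by rewrite mulrBr mulr1 mulrC divfK // lmon_neq0.
Qed.

End ClosedPoint.

Lemma nth_cat_mid (T : eqType) (x0 : T) (s1 s2 s3 : seq T) u : u \in s3 ->
  exists i, [/\ (size s1 <= i)%N, (i < size (s1 ++ s2 ++ s3))%N & nth x0 (s1 ++ s2 ++ s3) i = u].
Proof.
move=> /(nthP x0)[i lti <-]; exists (size s1 + (size s2 + i))%N.
rewrite !size_cat !ltn_add2l leq_addr; split=> //.
by rewrite nth_cat ltnNge leq_addr addKn nth_cat ltnNge leq_addr addKn.
Qed.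

(** * The regular system of parameters *)

Section RegularParameters.
Variables (k : fieldType) (n : nat) (E : {set 'I_n}) (d : nat) (A : comAlgType k).
Variables (pi : {lrmorphism TA k n E -> A}) (j : {lrmorphism A -> torus k d}).
Variable tau : {lrmorphism torus k n -> torus k d}.
Hypothesis hV : toric_embedding pi j tau.
Variable M : 'M[int]_(n, d).
Hypothesis tauM : forall i, tau (torus_var k i) = torus_char k (row i M).
Variable xi : prime_idealr (TA k n E).
Hypothesis max_xi : maximal_ideal xi.
Hypothesis pi_xi : forall f, pi f = 0 -> f \in xi.
Hypothesis wL : weak_transversal E (toric_lattice tau).
Local Notation poly := (@TA_of_poly k n E).
Local Notation lp := (lpoly xi).
Local Notation m_xi := (local_max (xi := xi)).
Local Notation I_xi := (ideal_at (xi := xi) (fun f => pi f = 0)).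
Local Notation Z := (zeros_at xi).
Local Notation c := #|~: Z|.

(** The standard basis of the lattice of exponents vanishing on [Z]. *)
Definition unit_coords : 'M[int]_(c, n) := rowsub enum_val 1%:M.
Local Notation B := unit_coords.

Lemma unit_coords_zero (a : 'rV[int]_c) h : h \in Z -> (a *m B) 0 h = 0.
Proof.
move=> hZ; rewrite mxE big1 // => l _; rewrite !mxE; case: eqP => [lh|_]; last by rewrite mulr0.
by have := enum_valP l; rewrite lh inE hZ.
Qed.

Lemma unit_coords_surj (b : 'rV[int]_n) : (forall h, h \in Z -> b 0 h = 0) ->
  exists a, b = a *m B.
Proof.
move=> b0; exists (\row_l b 0 (enum_val l)); apply/rowP => h.
have [hZ|hZ] := boolP (h \in Z); first by rewrite b0 // unit_coords_zero.
have hZ' : h \in ~: Z by rewrite inE.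
rewrite !mxE (bigD1 (enum_rank_in hZ' h)) //= !mxE enum_rankK_in // eqxx mulr1 big1 ?addr0 // => l ll.
rewrite !mxE; case: eqP => [lh|_]; last by rewrite mulr0.
by case/eqP: ll; apply: enum_val_inj; rewrite enum_rankK_in.
Qed.

Lemma transversal_at_of_lattice : transversal_at xi (fun f => pi f = 0).
Proof.
have M0 := lattice_zero_at hV tauM pi_xi wL.
have [F FP] := choice (fun a : 'rV[int]_c => unit_character (unit_coords_zero a)).
have FE a := (FP a).1; have Fm a := (FP a).2.
have [U [V [S [_ VU US VS]]]] := kernel_adapted_basis (B *m M).
pose w l := F (row l U).
(* The order matters: the first [r] entries must produce the generators of [I(V)]. *)
pose ws := [seq w l | l in S] ++ [seq w l | l in ~: S] ++ [seq lp 'X_h | h in Z].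
have sws : size ws = n.
  rewrite !size_cat !size_map -!cardE addnA cardsC card_ord -[RHS]card_ord.
  by rewrite -(cardsC Z) addnC.
have [gs [sgs gsE Jgs]] := triangular_generators (residue_algebraic max_xi) ws (th := idfun)
  (rho := loc_const xi) (fun=> erefl).
have gs0 i : (i < n)%N -> residue xi gs`_i = 0.
  by move=> lti; have [] := gsE i; rewrite ?sws.
pose r := #|S|; pose y (i : 'I_n) := gs`_i.
have r_size : size [seq w l | l in S] = r by rewrite size_map -cardE.
have ler : (r <= n)%N by rewrite -sws size_cat r_size leq_addr.
have wI l : l \in S -> I_xi (w l - 1).
  by move=> lS; apply: (unit_char_sub1 hV tauM FE unit_coords_zero); apply: US.
have I_ideal : is_ideal I_xi.
  apply: ideal_at_is_ideal => u v; first by move=> u0 v0; rewrite rmorphD [X in X + _]u0 [X in _ + X]v0 addr0.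
  by move=> v0; rewrite rmorphM [X in _ * X]v0 mulr0.
have I0 : I_xi 0 by rewrite -(rmorph0 (loc xi)); apply: ideal_at_loc; rewrite rmorph0.
have I_max f : I_xi f -> f \in m_xi.
  by move=> /ideal_atP[a [s [/pi_xi axi sxi sf]]]; apply/local_maxP/ideal_atP; exists a, s.
(* [w l] has residue 1 because [w l - 1] lies in [I(V)]; the third clause of [minimal_monic] then
   gives exactly [w l - 1]. *)
have gsw i l : (i < n)%N -> l \in S -> ws`_i = w l -> gs`_i = w l - 1.
  move=> lti lS wsi; have [|_ /(_ 1)] := gsE i; first by rewrite sws.
  rewrite rmorph1 wsi; apply; apply/eqP; rewrite rmorph1 -subr_eq0 -(rmorph1 (residue xi)).
  by rewrite -rmorphB residue_eq0; apply: I_max; apply: wI.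
have gsx i h : (i < n)%N -> h \in Z -> ws`_i = lp 'X_h -> gs`_i = lp 'X_h.
  move=> lti hZ wsi; have [|_ /(_ 0)] := gsE i; first by rewrite sws.
  rewrite rmorph0 subr0 wsi; apply; apply/eqP; rewrite rmorph0 residue_eq0 lpoly_max.
  by rewrite inE in hZ.
have gs_lt i : (i < r)%N -> exists2 l, l \in S & gs`_i = w l - 1.
  move=> ir; have : ws`_i \in [seq w l | l in S].
    by rewrite nth_cat r_size ir mem_nth // r_size.
  move=> /mapP[l lS wsi]; exists l; first by rewrite mem_enum in lS.
  by apply: gsw => //; [exact: leq_trans ler | rewrite mem_enum in lS].
have gs_S l : l \in S -> exists2 i : 'I_n, (i < r)%N & y i = w l - 1.
  move=> lS; have : w l \in [seq w l | l in S] by apply: map_f; rewrite mem_enum.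
  move=> /(nthP 0)[i]; rewrite r_size => ir wi.
  have lti := leq_trans ir ler; exists (Ordinal lti) => //; apply: gsw => //.
  by rewrite nth_cat r_size ir.
exists r, y; split=> //.
- split; first exact: krull_dim_local.
  move=> f; split.
    move=> /local_maxP fm.
    have yid := ideal_gen_is_ideal predT y; have y0 := ideal_gen0 predT y.
    have wsU l : F (row l U) \in ws.
      rewrite !mem_cat orbA; have [lS|lS] := boolP (l \in S).
        by rewrite (map_f w) ?mem_enum.
      by rewrite orbC; apply/orP; right; apply/orP; right; apply: (map_f w); rewrite mem_enum inE.
    have wsZ h : h \in Z -> lp 'X_h \in ws.
      by move=> hZ; rewrite !mem_cat orbA [X in _ || X](map_f (fun h => lp 'X_h)) ?orbT ?mem_enum.
    have [v [g [gv gg vm vf]]] := gen_frac_all unit_coords_surj FE Fm VU wsU wsZ f.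
    have [u uv] := local_unit vm; rewrite -[f]mul1r -uv -mulrA vf.
    apply: yid.2; apply: (Jgs (ideal_gen predT y)) => //.
    (* The bottom of the tower is [k], where only 0 has residue 0. *)
    + move=> z /eqP; rewrite -[residue xi _]/((residue xi \o loc_const xi) z) fmorph_eq0 => /eqP->.
      by rewrite rmorph0.
    + by move=> i; rewrite sgs sws => lti; apply: (@ideal_gen_mem _ _ _ y (Ordinal lti)).
    by apply/eqP; rewrite residue_eq0 -vf (idealr_closedM (local_max_idealr_closed xi)).
  move=> fy; apply/local_maxP; rewrite -residue_eq0; apply/eqP.
  have [cc ->] := fy; rewrite rmorph_sum big1 // => i _.
  by rewrite rmorphM gs0 ?mulr0.
- have yid := ideal_gen_is_ideal (fun i : 'I_n => (i < r)%N) y.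
  have y0 := ideal_gen0 (fun i : 'I_n => (i < r)%N) y.
  move=> f; split; last first.
    by apply: ideal_gen_sub => // i /gs_lt[l lS]; rewrite /y => ->; apply: wI.
  have [p [s [sxi sf]]] := lpoly_frac f => fI.
  have [u us] := lpoly_unit sxi; rewrite -[f]mul1r -us -mulrA sf.
  apply: yid.2; apply: (kernel_poly_sub unit_coords_surj FE VU VS yid y0 _ M0).
    by move=> l /gs_S[i ir <-]; apply: ideal_gen_mem.
  apply/(poly_tau_eq0 tauM)/(embedding_poly_idealE hV).
  (* Descent of [p] from the local ring to [I(V)]: some [t] outside [xi] has [t p] in [I(V)], [t]
     does not vanish on [V], and [A] is a domain. *)
  have [a [t [a0 txi tf]]] := (ideal_atP _ _).1 fI.
  have tp : t * poly p = poly s * a.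
    by apply: (@loc_inj _ _ _ xi); rewrite !rmorphM /= -tf -!lpolyE -sf mulrCA.
  have ptp : pi t * pi (poly p) = 0.
    by rewrite -(rmorphM pi) tp (rmorphM pi) [X in _ * X]a0 mulr0.
  have /orP[/eqP/pi_xi|/eqP//] := toric_integral (embedding_toric hV) ptp.
  by rewrite (negPf txi).
move=> h hE hxi; have hZ : h \in Z.
  by rewrite inE (_ : poly 'X_h = TA_var k E h) //; apply: val_inj.
have [|i [ir iws wsi]] := @nth_cat_mid _ 0 [seq w l | l in S] [seq w l | l in ~: S]
  [seq lp 'X_h | h in Z] (lp 'X_h).
  by apply: (map_f (fun h => lp 'X_h)); rewrite mem_enum.
rewrite r_size in ir; rewrite -/ws sws in iws.
exists (Ordinal iws) => // f.
have yE : y (Ordinal iws) = loc xi (TA_var k E h).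
  rewrite /y (gsx _ _ iws hZ wsi) lpolyE; congr loc; exact: val_inj.
split.
  move=> /ideal_atP[a [s [[e ->] sxi sf]]]; have [u us] := loc_unit sxi.
  exists (fun=> u * loc xi (e ord0)); rewrite big_pred1_eq yE.
  by rewrite -mulrA -rmorphM -[f]mul1r -us -mulrA sf big_ord1.
apply: ideal_gen_sub.
- by apply: ideal_at_is_ideal => u v; [exact: ideal_genD | exact: ideal_genM].
- by rewrite -(rmorph0 (loc xi)); apply: ideal_at_loc; apply: ideal_gen0.
move=> l /eqP->; rewrite yE; apply: ideal_at_loc.
exact: (@ideal_gen_mem _ 1 predT (fun=> TA_var k E h) ord0).
Qed.
End RegularParameters.

Theorem proposition3p9 (k : fieldType) (hk : perfect_field k)
    (n : nat) (E : {set 'I_n}) (d : nat) (A : comAlgType k)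
    (pi : {lrmorphism TA k n E -> A}) (j : {lrmorphism A -> torus k d})
    (tau : {lrmorphism torus k n -> torus k d})
    (hV : toric_embedding pi j tau) :
  geom_transversal (fun f : TA k n E => pi f = 0) <->
  lattice_transversal E (toric_lattice tau).
Proof.
have [M tauM] := exponent_matrix hV.
split=> [|[wL _] xi max_xi pi_xi]; first exact: (lattice_transversal_of_geom hV tauM).
exact: (transversal_at_of_lattice hV tauM max_xi pi_xi wL).
Qed.
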